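(* Let $(M_1\times_fM_2,F)$ be a twisted product Finsler manifold and suppose $f$ is constant on $M_1$. Then $(M_1\times_fM_2,F)$ is Berwaldian if and only if $(M_1,F_1)$ is Berwaldian and the Berwald curvature of $(M_2,F_2)$ satisfies $$\begin{aligned}B^\gamma_{\alpha\beta\lambda}=-f^{-1}\big(&C^{\gamma\nu}_{\beta;\alpha;\lambda}f_\nu F_2^2+2C^{\gamma\nu}_{\beta;\alpha}f_\nu v_\lambda+2C^{\gamma\nu}_{\lambda;\alpha}f_\nu v_\beta+2C^{\gamma\nu}_{\alpha}f_\nu g_{\lambda\beta}\\&+2C^{\gamma\nu}_{\beta;\lambda}f_\nu v_\alpha+2C^{\gamma\nu}_{\beta}f_\nu g_{\lambda\alpha}+2C^{\gamma\nu}_\lambda f_\nu g_{\alpha\beta}-2g^{\gamma\nu}C_{\alpha\beta\lambda}f_\nu\big).\end{aligned}$$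
   Context: Let $(M_1,F_1)$, $(M_2,F_2)$ be Finsler manifolds (metrics smooth on the slit tangent bundle, positively 1-homogeneous on fibres, with positive definite fundamental tensor) and $f:M_1\times M_2\to\mathbb{R}^+$ smooth. The twisted product $M_1\times_f M_2$ is $M=M_1\times M_2$ with $F=\sqrt{F_1^2(x,y)+f^2(x,u)F_2^2(u,v)}$, considered where $y\ne0$, $v\ne 0$. Local coordinates are $(x^i,u^\alpha)$ with fibre coordinates $(y^i,v^\alpha)$. For a Finsler metric $F$ with fundamental tensor $g_{ij}=\frac12(F^2)_{y^iy^j}$, the spray coefficients are $G^i=\frac14g^{il}\big(\frac{\partial^2F^2}{\partial x^k\partial y^l}y^k-\frac{\partial F^2}{\partial x^l}\big)$ and the Berwald curvature is $B^i_{\ jkl}=\frac{\partial^3G^i}{\partial y^j\partial y^k\partial y^l}$; $F$ is Berwaldian if $B^i_{\ jkl}=0$. For $F_2$: $g_{\alpha\beta}=\frac12(F_2^2)_{v^\alpha v^\beta}$, $v_\alpha=g_{\alpha\beta}v^\beta$, $C_{\alpha\beta\gamma}=\frac12\frac{\partial g_{\alpha\beta}}{\partial v^\gamma}$, $C^{\gamma\nu}_\alpha=g^{\gamma\mu}g^{\nu\kappa}C_{\mu\kappa\alpha}$; a subscript $;\beta$ denotes $\partial/\partial v^\beta$; $f_\nu=\partial f/\partial u^\nu$; $B^\gamma_{\alpha\beta\lambda}$ is the Berwald curvature of $F_2$. ''$f$ is constant on $M_1$'' means $\partial f/\partial x^i=0$. *)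

(* Defs.v *)
From HB Require Import structures.
From mathcomp Require Export all_boot all_order all_algebra.
From mathcomp Require Export all_classical all_reals all_analysis.

Set Implicit Arguments.
Unset Strict Implicit.
Unset Printing Implicit Defensive.

Import Order.TTheory GRing.Theory Num.Theory.
Import numFieldNormedType.Exports.

Local Open Scope classical_set_scope.
Local Open Scope ring_scope.

(** * C^oo maps between normed spaces *)

Fixpoint iter_derive (R : realType) (V W : normedModType R)
    (vs : seq V) (h : V -> W) : V -> W :=
  if vs is v :: vs' then 'D_v (iter_derive vs' h) else h.

(* Only used for an open set D of a finite-dimensional V, where this is the
   usual notion: all iterated (directional) derivatives exist and are
   continuous on D. *)
Definition smooth_on (R : realType) (V W : normedModType R)
    (D : set V) (h : V -> W) : Prop :=
  forall (vs : seq V) (x : V), D x ->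
    {for x, continuous (iter_derive vs h)} /\
    (forall v : V, derivable (iter_derive vs h) x v).

(** * Manifolds *)

(* [unchart i] is the local parametrization inverse to [chart i]; both are total
   functions, meaningful on [chart_dom i] and on its image only. *)
Record atlas (R : realType) (n : nat) (M : Type) := Atlas {
  chart_idx : Type;
  chart_dom : chart_idx -> set M;
  chart : chart_idx -> M -> 'rV[R]_n;
  unchart : chart_idx -> 'rV[R]_n -> M
}.

Definition chart_img (R : realType) (n : nat) (M : Type) (A : atlas R n M)
    (i : chart_idx A) : set 'rV[R]_n := chart i @` chart_dom i.

Definition transition (R : realType) (n : nat) (M : Type) (A : atlas R n M)
    (i j : chart_idx A) : 'rV[R]_n -> 'rV[R]_n :=
  fun x => chart j (unchart i x).

Record smooth_manifold (R : realType) (n : nat) (M : topologicalType)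
    (A : atlas R n M) : Prop := SmoothManifold {
  manifold_hausdorff : hausdorff_space M;
  manifold_second_countable : @second_countable M;
  chart_cover : forall p : M, exists i : chart_idx A, chart_dom i p;
  chart_dom_open : forall i : chart_idx A, open (chart_dom i);
  chart_img_open : forall i : chart_idx A, open (chart_img i);
  chartK : forall (i : chart_idx A) (p : M),
    chart_dom i p -> unchart i (chart i p) = p;
  chart_continuous : forall (i : chart_idx A) (p : M),
    chart_dom i p -> {for p, continuous (chart i)};
  unchart_continuous : forall (i : chart_idx A) (x : 'rV[R]_n),
    chart_img i x -> {for x, continuous (unchart i)};
  transition_smooth : forall i j : chart_idx A,
    smooth_on (chart i @` (chart_dom i `&` chart_dom j)) (transition i j)
}.

Definition prod_atlas (R : realType) (n1 n2 : nat) (M1 M2 : Type)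
    (A1 : atlas R n1 M1) (A2 : atlas R n2 M2) :
    atlas R (n1 + n2) (M1 * M2)%type :=
  {| chart_idx := (chart_idx A1 * chart_idx A2)%type;
     chart_dom := fun ab => chart_dom ab.1 `*` chart_dom ab.2;
     chart := fun ab pq => row_mx (chart ab.1 pq.1) (chart ab.2 pq.2);
     unchart := fun ab z => (unchart ab.1 (lsubmx z), unchart ab.2 (rsubmx z))
  |}.

Definition smooth_fun (R : realType) (n : nat) (M : Type) (A : atlas R n M)
    (h : M -> R) : Prop :=
  forall i : chart_idx A, smooth_on (chart_img i) (fun x => h (unchart i x) : R^o).

(* The partial derivative of h at p with respect to the k-th coordinate of the
   chart i. *)
Definition coord_deriv (R : realType) (n : nat) (M : Type) (A : atlas R n M)
    (i : chart_idx A) (k : 'I_n) (h : M -> R) (p : M) : R :=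
  'D_(delta_mx 0 k) (fun x => h (unchart i x) : R^o) (chart i p).

(** * Local Finsler geometry, in coordinates z = (x, y) of the tangent bundle *)

Section Local.
Variables (R : realType) (n : nat).
Local Notation TU := ('rV[R]_n * 'rV[R]_n)%type.
Implicit Types (F h : TU -> R) (z : TU).

Definition dx (k : 'I_n) h z : R :=
  'D_((delta_mx 0 k, 0) : TU) (h : TU -> R^o) z.

Definition dy (k : 'I_n) h z : R :=
  'D_((0, delta_mx 0 k) : TU) (h : TU -> R^o) z.

Definition sqF F z : R := F z ^+ 2.

Definition fund F z : 'M[R]_n :=
  \matrix_(i, j) (2^-1 * dy j (dy i (sqF F)) z).

Definition fund_inv F z : 'M[R]_n := invmx (fund F z).

Definition spray F (i : 'I_n) z : R :=
  4^-1 * \sum_(l < n) fund_inv F z i l *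
    (\sum_(k < n) dx k (dy l (sqF F)) z * z.2 0 k - dx l (sqF F) z).

Definition berwald F (i j k l : 'I_n) z : R := dy l (dy k (dy j (spray F i))) z.

Definition lower_y F (a : 'I_n) z : R := \sum_(b < n) fund F z a b * z.2 0 b.

Definition cartan F (a b c : 'I_n) z : R :=
  2^-1 * dy c (fun w => fund F w a b) z.

(* [cartan_up F c d a] is C^{cd}_a. *)
Definition cartan_up F (c d a : 'I_n) z : R :=
  \sum_(m < n) \sum_(k < n)
    fund_inv F z c m * fund_inv F z d k * cartan F m k a z.

End Local.

(** * Finsler metrics *)

(* A function on the tangent bundle, given by its expressions
   F i : (x, y) |-> F i (x, y) in the charts; tangent vectors at p are classes of
   pairs (i, y), where (i, y) ~ (j, y') iff y' is the image of y under the
   Jacobian of the transition map at chart i p (condition [finsler_compat]). *)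
Definition local_metric (R : realType) (n : nat) (M : Type) (A : atlas R n M) :=
  chart_idx A -> 'rV[R]_n * 'rV[R]_n -> R.

Definition slit (R : realType) (n : nat) : set 'rV[R]_n := [set y | y != 0].

Record finsler (R : realType) (n : nat) (M : Type) (A : atlas R n M)
    (F : local_metric A) : Prop := Finsler {
  finsler_compat : forall (i j : chart_idx A) (p : M) (y : 'rV[R]_n),
    chart_dom i p -> chart_dom j p ->
    F j (chart j p, 'D_y (transition i j) (chart i p)) = F i (chart i p, y);
  finsler_ge0 : forall (i : chart_idx A) (x y : 'rV[R]_n),
    chart_img i x -> 0 <= F i (x, y);
  finsler_smooth : forall i : chart_idx A,
    smooth_on (chart_img i `*` @slit R n)
      (F i : 'rV[R]_n * 'rV[R]_n -> R^o);
  finsler_homog : forall (i : chart_idx A) (x y : 'rV[R]_n) (c : R),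
    chart_img i x -> 0 < c -> F i (x, c *: y) = c * F i (x, y);
  finsler_posdef : forall (i : chart_idx A) (x y w : 'rV[R]_n),
    chart_img i x -> y != 0 -> w != 0 ->
    0 < (w *m fund (F i) (x, y) *m w^T) 0 0
}.

(* D is the set of (coordinate) tangent vectors at which F is considered. *)
Definition berwaldian_on (R : realType) (n : nat) (M : Type) (A : atlas R n M)
    (D : set 'rV[R]_n) (F : local_metric A) : Prop :=
  forall (a : chart_idx A) (p : M) (y : 'rV[R]_n), chart_dom a p -> D y ->
  forall i j k l : 'I_n, berwald (F a) i j k l (chart a p, y) = 0.

Definition berwaldian (R : realType) (n : nat) (M : Type) (A : atlas R n M)
    (F : local_metric A) : Prop := berwaldian_on (@slit R n) F.

(** * Twisted products *)

Definition twisted_metric (R : realType) (n1 n2 : nat) (M1 M2 : Type)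
    (A1 : atlas R n1 M1) (A2 : atlas R n2 M2)
    (F1 : local_metric A1) (F2 : local_metric A2) (f : M1 * M2 -> R) :
    local_metric (prod_atlas A1 A2) :=
  fun ab z =>
    Num.sqrt (F1 ab.1 (lsubmx z.1, lsubmx z.2) ^+ 2 +
              f (unchart ab z.1) ^+ 2 *
              F2 ab.2 (rsubmx z.1, rsubmx z.2) ^+ 2).

(* The twisted metric is only smooth where both fibre components (y, v) are
   nonzero. *)
Definition bislit (R : realType) (n1 n2 : nat) : set 'rV[R]_(n1 + n2) :=
  [set w | lsubmx w != 0 /\ rsubmx w != 0].

Definition twisted_berwaldian (R : realType) (n1 n2 : nat) (M1 M2 : Type)
    (A1 : atlas R n1 M1) (A2 : atlas R n2 M2)
    (F1 : local_metric A1) (F2 : local_metric A2) (f : M1 * M2 -> R) : Prop :=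
  berwaldian_on (@bislit R n1 n2) (twisted_metric F1 F2 f).

Definition constant_on_fst (R : realType) (n1 : nat) (M1 M2 : Type)
    (A1 : atlas R n1 M1) (f : M1 * M2 -> R) : Prop :=
  forall (a : chart_idx A1) (i : 'I_n1) (p : M1) (q : M2),
    chart_dom a p -> coord_deriv a i (fun p' => f (p', q)) p = 0.

(* Main.v *)
Require Import Defs.
From HB Require Import structures.
From mathcomp Require Import all_boot all_order all_algebra.
From mathcomp Require Import all_classical all_reals all_analysis.
From mathcomp Require Import ring.

Set Implicit Arguments.
Unset Strict Implicit.
Unset Printing Implicit Defensive.

Import Order.TTheory GRing.Theory Num.Theory.
Import numFieldNormedType.Exports.

Local Open Scope classical_set_scope.
Local Open Scope ring_scope.

(** Writing [F^2 = F1^2 + f^2 F2^2], the fundamental tensor of the twisted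
    product is block diagonal with blocks [g1] and [f^2 g2].  As [f] does not
    depend on [M1], its spray is [G1^i] on the first factor and, by Euler's
    identity [(F2^2)_{v^b} = 2 v_b],
      [G2^a + f^-1 f_nu (v^nu v^a - g^{a nu} F2^2 / 2)]
    on the second.  The term [v^nu v^a] is quadratic in the fibre, so three
    fibre derivatives leave [B1] on the first factor,
      [B2 - (2 f)^-1 f_nu (g^{c nu} F2^2)_{;a;b;l}]
    on the second, and [0] for mixed indices; expanding the last derivative with
    [g^{c nu}_{;b} = -2 C^{c nu}_b] gives the stated condition.  The symmetries
    of the tensors involved and the linearity of the directional derivative in
    its direction are derived from [smooth_on] by the mean value theorem. *)

(** * Directional derivatives *)

(** [smooth_on] speaks of one direction at a time and provides no total derivative, yet tensor
    calculus needs more: Euler's identity uses additivity in the direction, and the symmetry of g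
    and of the derivatives of C uses commuting partial derivatives. Both come from difference
    quotients on small parallelograms.

    The identities for the twisted metric hold only on the open set where both fibre components are
    nonzero, so each one is differentiated by locality. The expressions met on the way are kept in
    shapes that fibre derivatives preserve, with coefficients depending on the base point alone;
    three derivatives then cost no more than one.

    Vectors with one fibre component equal to 0 are excluded, so a vector of one factor must be
    completed by a nonzero vector of the other. This is where positive dimensions and nonempty
    factors enter.

    Constancy of f on M1 means vanishing partial derivatives. On a disconnected M1 the value f(p, q)
    may still depend on the component of p, which is why the curvature condition ranges over p. *)

Section DirectionalDerivative.
Variable R : realType.

(** A directional derivative sees only the restriction to a line, so it can be moved between
    different spaces. Scaling, translation, composition with a linear map and the passage to charts
    all reduce to this. *)
Lemma derive_line (V V' W : normedModType R) (f : V -> W) (g : V' -> W)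
    (a v : V) (b w : V') :
  (forall t : R, f (t *: v + a) = g (t *: w + b)) -> 'D_v f a = 'D_w g b.
Proof.
move=> fg; have fg0 : f a = g b by have := fg 0; rewrite !scale0r !add0r.
rewrite /derive; set p := fun h : R => _; set q := fun h : R => _.
by rewrite (_ : p = q)//; apply/funext => t; rewrite /p /q /= fg fg0.
Qed.

Lemma derivable_line (V V' W : normedModType R) (f : V -> W) (g : V' -> W)
    (a v : V) (b w : V') :
  (forall t : R, f (t *: v + a) = g (t *: w + b)) ->
  derivable f a v -> derivable g b w.
Proof.
move=> fg; have fg0 : f a = g b by have := fg 0; rewrite !scale0r !add0r.
rewrite /derivable; set p := (X in cvg (X @ _) -> _).
rewrite (_ : p = fun h : R => h^-1 *: ((g \o shift b) (h *: w) - g b)) //.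
by apply/funext => t; rewrite /p /= fg fg0.
Qed.

(** On the line through x the function has one real variable, where derivability amounts to
    differentiability; the differential is linear, which also covers t = 0. *)
Lemma is_derive_scale (V W : normedModType R) (f : V -> W) (x v : V) (t : R) :
  derivable f x v -> is_derive x (t *: v) f (t *: 'D_v f x).
Proof.
move=> dfv; pose g (s : R) := f (s *: v + x).
have dg : differentiable g 0 by exact/derivable1_diffP/(derivable1P _ _ _).1.
have eq1 (s : R) : g (s *: t + 0) = f (s *: (t *: v) + x).
  by rewrite /g addr0 scalerA.
have eq2 (s : R) : g (s *: 1 + 0) = f (s *: v + x).
  by rewrite /g addr0 [_%:A]mulr1.
apply: DeriveDef; first exact: derivable_line eq1 (diff_derivable dg).
rewrite -(derive_line eq1) -(derive_line eq2) !deriveE//.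
by rewrite -[in LHS](mulr1 t) -[t * 1]/(t *: (1 : R^o)) linearZ.
Qed.

Lemma MVT_line (V : normedModType R) (h : V -> R^o) (x v : V) :
  (forall c : R, c \in `[0, 1]%R -> derivable h (c *: v + x) v) ->
  exists2 c : R, c \in `[0, 1]%R & h (v + x) - h x = 'D_v h (c *: v + x).
Proof.
move=> dh; pose g (s : R) : R := h (s *: v + x).
have gE (s t : R) : h (t *: v + (s *: v + x)) = g (t *: 1 + s).
  by rewrite /g addrA -scalerDl [_%:A]mulr1.
pose g' (s : R) : R := 'D_v h (s *: v + x).
have dg (s : R) : s \in `[0, 1]%R -> is_derive s (1 : R) g (g' s).
  move=> s01; apply: DeriveDef; first exact: derivable_line (gE s) (dh s s01).
  by rewrite /g' (derive_line (gE s)).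
have dgo (s : R) : s \in `]0, 1[%R -> is_derive s (1 : R) g (g' s).
  by rewrite in_itv/= => /andP[s0 s1]; apply: dg; rewrite in_itv/= !ltW.
have cg : {within `[0, 1], continuous g}.
  by apply: derivable_within_continuous => s /dg[].
have [c c01] := MVT_segment ler01 dgo cg.
rewrite /g /g' scale1r scale0r add0r subr0 mulr1 => e.
by exists c.
Qed.

(** Uniformity in c and d is the point: the mean value theorem yields uncontrolled intermediate
    points, and all of them must lie in U. *)
Lemma near_parallelogram (V : normedModType R) (x v w : V) (U : set V) :
  nbhs x U -> \forall s \near (0 : R)^', forall c d : R,
    c \in `[0, 1]%R -> d \in `[0, 1]%R ->
    U (c *: (s *: v) + (d *: (s *: w) + x)).
Proof.
(* The summand 1 keeps the divisor of e positive when v = w = 0. *)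
move=> /nbhs_normP[e /= e0 eU]; pose k := `|v| + `|w| + 1.
have k0 : 0 < k by rewrite ltr_wpDl// addr_ge0.
near=> s => c d; rewrite !in_itv/= => /andP[c0 c1] /andP[d0 d1].
apply: eU; rewrite /ball_ /= addrA opprD addrCA subrr addr0 normrN.
apply: (@le_lt_trans _ _ (`|s| * k)).
  apply: (le_trans (ler_normD _ _)); rewrite !normrZ (ger0_norm c0) (ger0_norm d0).
  rewrite /k !mulrDr mulr1 -[leLHS]addr0 lerD// lerD//; apply: ler_piMl => //;
    exact: mulr_ge0.
rewrite -ltr_pdivlMr//; near: s.
by apply: dnbhs0_lt; rewrite divr_gt0.
Unshelve. all: by end_near. Qed.

(* Difference quotients along v + w telescope into one along v and one along w,
   and the mean value theorem rewrites each as a derivative at a nearby point. *)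
Lemma is_derive_add_dir (V : normedModType R) (h : V -> R^o) (x v w : V) :
  (\forall y \near x, derivable h y v /\ derivable h y w) ->
  {for x, continuous ('D_v h)} -> {for x, continuous ('D_w h)} ->
  is_derive x (v + w) h ('D_v h x + 'D_w h x).
Proof.
move=> dh cv cw.
suff cvh : (fun t : R => t^-1 *: ((h \o shift x) (t *: (v + w)) - h x)) @ 0^'
    --> ('D_v h x + 'D_w h x : R^o).
  by apply: DeriveDef; [apply/cvg_ex; eexists; exact: cvh|exact: cvg_lim cvh].
apply/cvgrPdist_le => e e0.
have e20 : 0 < e / 2 by rewrite divr_gt0.
have {}cv : \forall y \near x, `|'D_v h x - 'D_v h y| <= e / 2.
  by move/cvgrPdist_le : cv => /(_ _ e20).
have {}cw : \forall y \near x, `|'D_w h x - 'D_w h y| <= e / 2.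
  by move/cvgrPdist_le : cw => /(_ _ e20).
have U : \forall y \near x, (derivable h y v /\ derivable h y w) /\
    (`|'D_v h x - 'D_v h y| <= e / 2 /\ `|'D_w h x - 'D_w h y| <= e / 2).
  by apply: filterI => //; exact: filterI.
apply: filterS2 (nbhs_dnbhs_neq (0 : R)) (near_parallelogram w v U) => t t0 H.
have dhs (u y : V) : derivable h y u -> is_derive y (t *: u) h (t *: 'D_u h y).
  exact: is_derive_scale.
(* The first leg starts at x and goes along v: in [H] the coefficient of w is 0. The second leg
   starts at t v + x: there the coefficient of v is 1. *)
have [c c01 hv] : exists2 c : R, c \in `[0, 1]%R &
    h (t *: v + x) - h x = t * 'D_v h (c *: (t *: v) + x).
  have [c c01|c c01 ->] := @MVT_line V h x (t *: v).
    have [[dv _] _] := H 0 c (ltac:(by rewrite in_itv/= lexx ler01)) c01.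
    by rewrite scale0r add0r in dv; case: (dhs _ _ dv).
  have [[dv _] _] := H 0 c (ltac:(by rewrite in_itv/= lexx ler01)) c01.
  rewrite scale0r add0r in dv; exists c => //.
  by case: (dhs _ _ dv) => _ ->.
have [d d01 hw] : exists2 d : R, d \in `[0, 1]%R &
    h (t *: w + (t *: v + x)) - h (t *: v + x) =
    t * 'D_w h (d *: (t *: w) + (t *: v + x)).
  have [c' c01'|c' c01' ->] := @MVT_line V h (t *: v + x) (t *: w).
    have [[_ dw] _] := H c' 1 c01' (ltac:(by rewrite in_itv/= lexx ler01)).
    by rewrite scale1r in dw; case: (dhs _ _ dw).
  have [[_ dw] _] := H c' 1 c01' (ltac:(by rewrite in_itv/= lexx ler01)).
  rewrite scale1r in dw; exists c' => //.
  by case: (dhs _ _ dw) => _ ->.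
have -> : t^-1 *: ((h \o shift x) (t *: (v + w)) - h x) =
    'D_v h (c *: (t *: v) + x) + 'D_w h (d *: (t *: w) + (t *: v + x)).
  have -> : (h \o shift x) (t *: (v + w)) = h (t *: w + (t *: v + x)).
    by rewrite /= scalerDr addrCA addrA.
  rewrite -[_ - h x](subrKA (h (t *: v + x))) hw hv -mulrDr.
  by rewrite [_ *: _]mulKf// addrC.
rewrite opprD addrACA (le_trans (ler_normD _ _))// [e]splitr lerD//.
- have [_ [+ _]] := H 0 c (ltac:(by rewrite in_itv/= lexx ler01)) c01.
  by rewrite scale0r add0r.
- have [_ [_ ]] := H d 1 d01 (ltac:(by rewrite in_itv/= lexx ler01)).
  by rewrite scale1r.
Qed.

(** The mean value theorem is used twice: along v for the increment [g] of h in direction t w, then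
    along w for ['D_v h]. Each use contributes a factor t. *)
Lemma second_difference (V : normedModType R) (h : V -> R^o) (x v w : V) :
  (\forall y \near x, derivable h y v /\ derivable ('D_v h) y w) ->
  \forall t \near (0 : R)^', exists c d : R, [/\ c \in `[0, 1]%R, d \in `[0, 1]%R &
    h (t *: w + (t *: v + x)) - h (t *: v + x) - (h (t *: w + x) - h x) =
    t * t * 'D_w ('D_v h) (d *: (t *: w) + (c *: (t *: v) + x))].
Proof.
move=> dh; apply: filterS (near_parallelogram w v dh) => t H; pose g y : R^o := h (t *: w + y) - h y.
have itv0 : (0 : R) \in `[0, 1]%R by rewrite in_itv/= lexx ler01.
have itv1 : (1 : R) \in `[0, 1]%R by rewrite in_itv/= lexx ler01.
have dg c : c \in `[0, 1]%R -> is_derive (c *: (t *: v) + x) (t *: v) g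
    (t *: ('D_v h (t *: w + (c *: (t *: v) + x)) - 'D_v h (c *: (t *: v) + x))).
  move=> c01; have [+ _] := H 1 c itv1 c01; have [+ _] := H 0 c itv0 c01.
  rewrite scale1r scale0r add0r; set y := _ + x => d0 d1.
  pose htr z : R^o := h (t *: w + z).
  have eq_tr (s : R) : h (s *: v + (t *: w + y)) = htr (s *: v + y).
    by rewrite /htr addrCA.
  have dtr : is_derive y v htr ('D_v h (t *: w + y)).
    apply: DeriveDef; last by rewrite (derive_line eq_tr).
    exact: derivable_line eq_tr d1.
  have [dg eg] := is_deriveB dtr (derivableP d0).
  by rewrite -eg; exact: is_derive_scale.
have [|c c01] := @MVT_line V g x (t *: v); first by move=> c /dg[].
have [_ ->] := dg c c01.
have [|d d01] := @MVT_line V ('D_v h) (c *: (t *: v) + x) (t *: w).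
  by move=> d d01; have [_ dd] := H d c d01 c01; case: (is_derive_scale t dd).
have [_ dd] := H d c d01 c01; have [_ ->] := is_derive_scale t dd => -> gE.
exists c, d; split => //.
by rewrite -mulrA -[RHS]gE.
Qed.

(** The second difference is symmetric in v and w, so the two mixed derivatives agree at two points
    close to x; continuity at x closes the gap. *)
Lemma schwarz (V : normedModType R) (h : V -> R^o) (x v w : V) :
  (\forall y \near x, derivable h y v /\ derivable ('D_v h) y w) ->
  (\forall y \near x, derivable h y w /\ derivable ('D_w h) y v) ->
  {for x, continuous ('D_w ('D_v h))} -> {for x, continuous ('D_v ('D_w h))} ->
  'D_w ('D_v h) x = 'D_v ('D_w h) x.
Proof.
move=> dvw dwv cwv cvw; apply/eqP; rewrite -subr_eq0 -normr_le0.
apply/ler_addgt0Pl => e e0; rewrite addr0.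
have e20 : 0 < e / 2 by rewrite divr_gt0.
have {}cwv : \forall y \near x, `|'D_w ('D_v h) x - 'D_w ('D_v h) y| <= e / 2.
  by move/cvgrPdist_le : cwv => /(_ _ e20).
have {}cvw : \forall y \near x, `|'D_v ('D_w h) x - 'D_v ('D_w h) y| <= e / 2.
  by move/cvgrPdist_le : cvw => /(_ _ e20).
(* The goal does not mention t, so a single small nonzero t is enough. *)
apply: (@have_near _ _ (0 : R)^').
have := near_parallelogram v w cvw; apply: filter_app.
have := near_parallelogram w v cwv; apply: filter_app.
have := second_difference dwv; apply: filter_app.
have := second_difference dvw; apply: filter_app.
have := nbhs_dnbhs_neq (0 : R); apply: filter_app.
near=> t => t0 [c [d [c01 d01 E1]]] [c' [d' [c01' d01' E2]]].
move=> /(_ d c d01 c01) H1 /(_ d' c' d01' c01') H2.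
(* Exchanging v and w only reorders the four corner values, so [E1] and [E2] evaluate the same
   quantity, and t * t cancels. *)
move: E1; rewrite addrCA [LHS](_ : _ = h (t *: v + (t *: w + x)) -
    h (t *: w + x) - (h (t *: v + x) - h x)); last first.
  by rewrite !opprB addrACA [RHS]addrACA; congr (_ + _); rewrite addrC.
rewrite E2 => /(mulfI (mulf_neq0 t0 t0)) E; rewrite -E in H1.
pose y := d' *: (t *: v) + (c' *: (t *: w) + x).
apply: le_trans (ler_distD ('D_v ('D_w h) y) _ _) _.
rewrite [leRHS]splitr; apply: lerD; first exact: H1.
by rewrite distrC; exact: H2.
Unshelve. all: by end_near. Qed.

End DirectionalDerivative.

(** * Calculus of smooth functions *)

Section SmoothCalculus.
Variables (R : realType) (V : normedModType R) (D : set V).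
Hypothesis openD : open D.
Implicit Types (f g h : V -> R^o) (x v w : V).

Lemma smooth_on_continuous (W : normedModType R) (h : V -> W) x :
  smooth_on D h -> D x -> {for x, continuous h}.
Proof. by move=> sh Dx; case: (sh [::] x Dx). Qed.

Lemma smooth_on_derivable (W : normedModType R) (h : V -> W) x v :
  smooth_on D h -> D x -> derivable h x v.
Proof. by move=> sh Dx; case: (sh [::] x Dx) => _; apply. Qed.

Lemma smooth_on_derive (W : normedModType R) (h : V -> W) v :
  smooth_on D h -> smooth_on D ('D_v h).
Proof.
move=> sh vs x Dx.
have -> : iter_derive vs ('D_v h) = iter_derive (rcons vs v) h.
  by elim: vs => //= u vs ->.
exact: sh.
Qed.

(** As D is open, an identity on D holds near each of its points and may be differentiated there.
    Repeated derivatives below are computed by iterating this. *)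
Lemma derive_eq_on (W : normedModType R) (f g : V -> W) x v :
  (forall y, D y -> f y = g y) -> D x -> 'D_v f x = 'D_v g x.
Proof.
move=> fg Dx; apply: near_eq_derive.
by apply: filterS (open_nbhs_nbhs (conj openD Dx)) => y /fg.
Qed.

Lemma smooth_on_cst (W : normedModType R) (c : W) : smooth_on D (fun=> c).
Proof.
move=> vs x _.
suff [c' ->] : exists c' : W, iter_derive vs (fun _ : V => c) = cst c'.
  by split=> [|v]; [exact: cst_continuous|exact: derivable_cst].
elim: vs => [|v vs [c' /= ->]]; first by exists c.
by exists 0; apply/funext => y; rewrite derive_cst.
Qed.

Lemma is_derive_linear f x v :
  (forall (t : R) u y, f (t *: u + y) = t * f u + f y) -> is_derive x v f (f v).
Proof.
move=> lf; pose g (s : R) : R^o := s * f v + f x.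
have gE (t : R) : g (t *: 1 + 0) = f (t *: v + x).
  by rewrite lf /g addr0 [_%:A]mulr1.
have dg : is_derive (0 : R) (1 : R) g (f v).
  have -> : g = ( *:%R^~ (f v) : R -> R^o) + cst (f x : R^o) by [].
  have ds : is_derive (0 : R) (1 : R) ( *:%R^~ (f v : R^o) : R -> R^o) (f v).
    have ds : differentiable ( *:%R^~ (f v : R^o) : R -> R^o) (0 : R) by [].
    apply: DeriveDef; first exact: diff_derivable.
    by rewrite deriveE// diff_val scale1r.
  by rewrite -[f v in X in is_derive _ _ _ X]addr0; exact: is_deriveD.
apply: DeriveDef; first exact: derivable_line gE (@ex_derive _ _ _ _ _ _ _ dg).
by rewrite -(derive_line gE) derive_val.
Qed.

Lemma smooth_on_linear f :
  continuous f -> (forall (t : R) u y, f (t *: u + y) = t * f u + f y) ->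
  smooth_on D f.
Proof.
(* The last direction of the list is differentiated first and turns f into the constant [f v]. *)
move=> cf lf vs x Dx; case/lastP: vs => [|vs v].
  by split=> [|v]; [exact: cf|case: (is_derive_linear x v lf)].
have -> : iter_derive (rcons vs v) f = iter_derive vs (fun=> f v).
  elim: vs => /= [|u vs -> //]; apply/funext => y.
  by case: (is_derive_linear y v lf).
exact: smooth_on_cst.
Qed.

(* This class is stable under every ['D_v], so it consists of [smooth_on]
   functions; no Leibniz formula for iterated derivatives is needed. *)
Inductive smooth_alg : (V -> R^o) -> Prop :=
| alg_smooth h : smooth_on D h -> smooth_alg h
| alg_add f g : smooth_alg f -> smooth_alg g -> smooth_alg (fun x => f x + g x)
| alg_mul f g : smooth_alg f -> smooth_alg g -> smooth_alg (fun x => f x * g x)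
| alg_inv f : (forall x, D x -> f x != 0) -> smooth_alg f ->
    smooth_alg (fun x => (f x)^-1)
| alg_ext f g : (forall x, D x -> f x = g x) -> smooth_alg f -> smooth_alg g.

Lemma smooth_alg_C1 h x : smooth_alg h -> D x ->
  {for x, continuous h} /\ forall v, derivable h x v.
Proof.
move=> ah Dx; elim: ah => {h} [h sh|f g _ [cf df] _ [cg dg]|
    f g _ [cf df] _ [cg dg]|f f0 _ [cf df]|f g fg _ [cf df]].
- exact: sh [::] x Dx.
- by split=> [|v]; [exact: continuousD|exact: derivableD].
- by split=> [|v]; [exact: continuousM|exact: derivableM].
- split=> [|v]; first by apply: continuousV => //; exact: f0.
  by apply: derivableV => //; exact: f0.
- have nfg : {near x, f =1 g}.
    by apply: filterS (open_nbhs_nbhs (conj openD Dx)) => y /fg.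
  split=> [|v]; last exact: near_eq_derivable nfg (df v).
  suff : g @ x --> f x by rewrite (fg x Dx).
  by apply: cvg_trans cf; exact: near_eq_cvg.
Qed.

Lemma smooth_alg_derive h v : smooth_alg h -> smooth_alg ('D_v h).
Proof.
elim=> {h} [h sh|f g af adf ag adg|f g af adf ag adg|f f0 af adf|f g fg af adf].
- exact/alg_smooth/smooth_on_derive.
- apply: alg_ext (alg_add adf adg) => x Dx.
  have [_ df] := smooth_alg_C1 af Dx; have [_ dg] := smooth_alg_C1 ag Dx.
  by rewrite -deriveD.
- apply: alg_ext (alg_add (alg_mul af adg) (alg_mul ag adf)) => x Dx.
  have [_ df] := smooth_alg_C1 af Dx; have [_ dg] := smooth_alg_C1 ag Dx.
  exact/esym/deriveM.
(* The derivative of f^-1 is - f^-2 times that of f; the sign is a product with a smooth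
   constant. *)
- apply: alg_ext (alg_mul (alg_mul (alg_smooth (smooth_on_cst (-1 : R^o)))
    (alg_inv _ (alg_mul af af))) adf) => x Dx; last by rewrite mulf_neq0 ?f0.
  have [_ df] := smooth_alg_C1 af Dx.
  by rewrite deriveV ?f0// mulN1r.
- by apply: alg_ext adf => x Dx; apply: derive_eq_on.
Qed.

Lemma smooth_algE h : smooth_alg h -> smooth_on D h.
Proof.
move=> ah vs x; apply: smooth_alg_C1.
by elim: vs => //= v vs; exact: smooth_alg_derive.
Qed.

Lemma smooth_onD f g : smooth_on D f -> smooth_on D g ->
  smooth_on D (fun x => f x + g x : R^o).
Proof. by move=> sf sg; apply/smooth_algE/alg_add; exact: alg_smooth. Qed.

Lemma smooth_onM f g : smooth_on D f -> smooth_on D g ->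
  smooth_on D (fun x => f x * g x : R^o).
Proof. by move=> sf sg; apply/smooth_algE/alg_mul; exact: alg_smooth. Qed.

Lemma smooth_onV f : (forall x, D x -> f x != 0) -> smooth_on D f ->
  smooth_on D (fun x => (f x)^-1 : R^o).
Proof. by move=> f0 sf; apply/smooth_algE/alg_inv => //; exact: alg_smooth. Qed.

Lemma smooth_on_eq f g : (forall x, D x -> f x = g x) ->
  smooth_on D f -> smooth_on D g.
Proof. by move=> fg /alg_smooth sf; apply/smooth_algE/alg_ext/sf. Qed.

Lemma smooth_on_sum (I : Type) (r : seq I) (P : pred I) (F : I -> V -> R^o) :
  (forall i, smooth_on D (F i)) ->
  smooth_on D (fun x => \sum_(i <- r | P i) F i x : R^o).
Proof.
move=> sF; elim: r => [|i r IH].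
  by apply: smooth_on_eq (smooth_on_cst (0 : R^o)) => x _; rewrite big_nil.
apply: (@smooth_on_eq (fun x => (if P i then F i x else 0) +
    \sum_(j <- r | P j) F j x)) => [x _|].
  by rewrite big_cons; case: (P i); rewrite ?add0r.
apply: smooth_onD; last exact: IH.
by case: (P i); [exact: sF|exact: smooth_on_cst].
Qed.

Lemma smooth_on_prod (I : Type) (r : seq I) (P : pred I) (F : I -> V -> R^o) :
  (forall i, smooth_on D (F i)) ->
  smooth_on D (fun x => \prod_(i <- r | P i) F i x : R^o).
Proof.
move=> sF; elim: r => [|i r IH].
  by apply: smooth_on_eq (smooth_on_cst (1 : R^o)) => x _; rewrite big_nil.
apply: (@smooth_on_eq (fun x => (if P i then F i x else 1) *
    \prod_(j <- r | P j) F j x)) => [x _|].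
  by rewrite big_cons; case: (P i); rewrite ?mul1r.
apply: smooth_onM; last exact: IH.
by case: (P i); [exact: sF|exact: smooth_on_cst].
Qed.

Lemma derive_addE f g x v : smooth_on D f -> smooth_on D g -> D x ->
  'D_v (fun y => f y + g y : R^o) x = 'D_v f x + 'D_v g x.
Proof. by move=> sf sg Dx; rewrite -deriveD//; exact: smooth_on_derivable. Qed.

Lemma derive_mulE f g x v : smooth_on D f -> smooth_on D g -> D x ->
  'D_v (fun y => f y * g y : R^o) x = 'D_v f x * g x + f x * 'D_v g x.
Proof.
move=> sf sg Dx; have df := smooth_on_derivable (v := v) sf Dx.
have dg := smooth_on_derivable (v := v) sg Dx.
by rewrite [LHS](deriveM df dg) addrC mulrC.
Qed.

Lemma derive_mulcE f (c : R) x v : smooth_on D f -> D x ->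
  'D_v (fun y => c * f y : R^o) x = c * 'D_v f x.
Proof.
move=> sf Dx; rewrite (derive_mulE v (smooth_on_cst _) sf Dx).
by rewrite derive_cst mul0r add0r.
Qed.

Lemma derive_sumE n (F : 'I_n -> V -> R^o) x v :
  (forall i, smooth_on D (F i)) -> D x ->
  'D_v (fun y => \sum_(i < n) F i y : R^o) x = \sum_(i < n) 'D_v (F i) x.
Proof.
move=> sF Dx; rewrite -derive_sum => [|i]; last exact: smooth_on_derivable.
by congr ('D_v _ x); apply/funext => y; rewrite fct_sumE.
Qed.

Lemma derive_comm f x v w : smooth_on D f -> D x ->
  'D_w ('D_v f) x = 'D_v ('D_w f) x.
Proof.
move=> sf Dx; have nD := open_nbhs_nbhs (conj openD Dx).
apply: schwarz.
- apply: filterS nD => y Dy; split; first exact: smooth_on_derivable sf Dy.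
  by apply: smooth_on_derivable Dy; exact: smooth_on_derive.
- apply: filterS nD => y Dy; split; first exact: smooth_on_derivable sf Dy.
  by apply: smooth_on_derivable Dy; exact: smooth_on_derive.
- by apply: smooth_on_continuous Dx; do 2 apply: smooth_on_derive.
- by apply: smooth_on_continuous Dx; do 2 apply: smooth_on_derive.
Qed.

Lemma derive_dirD f x v w : smooth_on D f -> D x ->
  'D_(v + w) f x = 'D_v f x + 'D_w f x.
Proof.
move=> sf Dx; apply: (@derive_val _ _ _ _ _ _ _ (is_derive_add_dir _ _ _)).
- apply: filterS (open_nbhs_nbhs (conj openD Dx)) => y Dy.
  by split; exact: smooth_on_derivable.
- by apply: smooth_on_continuous Dx; exact: smooth_on_derive.
- by apply: smooth_on_continuous Dx; exact: smooth_on_derive.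
Qed.

Lemma derive_dirZ f x v (t : R) : smooth_on D f -> D x ->
  'D_(t *: v) f x = t * 'D_v f x.
Proof.
move=> sf Dx.
by have [_ ->] := is_derive_scale t (smooth_on_derivable (v := v) sf Dx).
Qed.

(** Expands the radial derivative along (0, y) into fibre partial derivatives for Euler's
    identity. *)
Lemma derive_dir_sum f x n (c : 'I_n -> R) (e : 'I_n -> V) :
  smooth_on D f -> D x ->
  'D_(\sum_(i < n) c i *: e i) f x = \sum_(i < n) c i * 'D_(e i) f x.
Proof.
move=> sf Dx; elim: (index_enum _) => [|i r IH].
  by rewrite !big_nil derive0.
by rewrite !big_cons derive_dirD// derive_dirZ// IH.
Qed.

(** * Determinants and inverses of matrix-valued functions *)

Lemma smooth_on_det n (A : V -> 'M[R]_n) :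
  (forall i j, smooth_on D (fun x => A x i j : R^o)) ->
  smooth_on D (fun x => \det (A x) : R^o).
Proof.
move=> sA; apply: smooth_on_sum => s; apply: smooth_onM.
  exact: smooth_on_cst.
by apply: smooth_on_prod => i; exact: sA.
Qed.

(** By Cramer's rule the entries are cofactors divided by the determinant; on D this is what [invmx]
    unfolds to, since A is invertible there. *)
Lemma smooth_on_invmx n (A : V -> 'M[R]_n) i j :
  (forall i j, smooth_on D (fun x => A x i j : R^o)) ->
  (forall x, D x -> A x \in unitmx) ->
  smooth_on D (fun x => (invmx (A x) : 'M[R]_n) i j : R^o).
Proof.
move=> sA uA; apply: (@smooth_on_eq (fun x =>
    (\det (A x))^-1 * ((-1) ^+ (j + i) * \det (row' j (col' i (A x)))))).
  by move=> x Dx; rewrite /invmx uA// !mxE.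
apply: smooth_onM; first apply: smooth_onV; last apply: smooth_onM.
- by move=> x /uA; rewrite unitmxE unitfE.
- exact: smooth_on_det.
- exact: smooth_on_cst.
- apply: smooth_on_det => k l.
  by apply: smooth_on_eq (sA (lift j k) (lift i l)) => x _; rewrite !mxE.
Qed.

(** Differentiating A A^-1 = 1 entrywise and multiplying by A^-1 on the left gives d(A^-1) = - A^-1
    (dA) A^-1. *)
Lemma derive_invmx n (A : V -> 'M[R]_n) i j x v :
  (forall i j, smooth_on D (fun x => A x i j : R^o)) ->
  (forall x, D x -> A x \in unitmx) -> D x ->
  'D_v (fun x => (invmx (A x) : 'M[R]_n) i j : R^o) x =
  - \sum_(m < n) \sum_(k < n)
      invmx (A x) i m * 'D_v (fun x => A x m k : R^o) x * invmx (A x) k j.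
Proof.
move=> sA uA Dx.
pose dA := \matrix_(m, k) 'D_v (fun x => A x m k : R^o) x.
pose dB := \matrix_(m, k) 'D_v (fun x => (invmx (A x) : 'M[R]_n) m k : R^o) x.
have sB m k := smooth_on_invmx m k sA uA.
have E : dA *m invmx (A x) + A x *m dB = 0.
  apply/matrixP => m k; rewrite !mxE -big_split/=.
  transitivity ('D_v (fun y => (1%:M : 'M[R]_n) m k : R^o) x); last first.
    by rewrite derive_cst.
  rewrite -(@derive_eq_on _ (fun y => \sum_l A y m l * invmx (A y) l k : R^o)).
  - rewrite derive_sumE//; last by move=> l; exact: smooth_onM.
    by apply: eq_bigr => l _; rewrite derive_mulE// !mxE.
  - by move=> y Dy; rewrite -(mulmxV (uA y Dy)) mxE.
  - exact: Dx.
have {}E : dB = - (invmx (A x) *m dA *m invmx (A x)).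
  move/(congr1 (mulmx (invmx (A x)))): E.
  rewrite mulmxDr mulmx0 !mulmxA mulVmx ?uA// mul1mx => /eqP.
  by rewrite addrC addr_eq0 => /eqP.
move/matrixP/(_ i j): E; rewrite !mxE => ->; congr (- _).
rewrite exchange_big/=; apply: eq_bigr => k _.
by rewrite !mxE mulr_suml; apply: eq_bigr => m _; rewrite !mxE.
Qed.

End SmoothCalculus.

(** * Composition with linear maps *)

Section SmoothComposition.
Variables (R : realType) (V V' : normedModType R) (L : V -> V').
Hypothesis linL : forall (t : R) v x, L (t *: v + x) = t *: L v + L x.

Lemma derive_comp_linear (W : normedModType R) (h : V' -> W) v x :
  'D_v (h \o L) x = 'D_(L v) h (L x).
Proof. by apply: derive_line => t /=; rewrite linL. Qed.

Lemma smooth_on_comp_linear (W : normedModType R) (D : set V) (D' : set V')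
    (h : V' -> W) : continuous L -> (forall x, D x -> D' (L x)) ->
  smooth_on D' h -> smooth_on D (h \o L).
Proof.
move=> cL DL sh vs x Dx.
have -> : iter_derive vs (h \o L) = iter_derive (map L vs) h \o L.
  elim: vs => //= v vs ->; apply/funext => y.
  exact: derive_comp_linear.
have [ch dh] := sh (map L vs) (L x) (DL x Dx).
split=> [|v]; first by apply: continuous_comp => //; exact: cL.
by apply: derivable_line (dh (L v)) => t /=; rewrite linL.
Qed.

End SmoothComposition.

(** * Finsler metrics in a chart *)

Lemma open_slit (R : realType) (n : nat) : open (@slit R n).
Proof.
rewrite (_ : @slit R n = ~` [set 0]); last first.
  by apply/seteqP; split=> y /=; [move/eqP|move=> y0; apply/eqP].
by apply/closed_openC/accessible_closed_set1/hausdorff_accessible/norm_hausdorff.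
Qed.

Lemma open_slit_bundle (R : realType) (n : nat) (U : set 'rV[R]_n) :
  open U -> open (U `*` @slit R n).
Proof.
move=> oU; rewrite (_ : _ `*` _ = fst @^-1` U `&` snd @^-1` @slit R n)//.
apply: openI; apply: open_comp.
- by move=> z _; exact: cvg_fst.
- exact: oU.
- by move=> z _; exact: cvg_snd.
- exact: open_slit.
Qed.

Lemma posdef_unitmx (R : realType) (n : nat) (A : 'M[R]_n) :
  (forall w : 'rV[R]_n, w != 0 -> 0 < (w *m A *m w^T) 0 0) -> A \in unitmx.
Proof.
move=> posA; rewrite -row_free_unit; apply/inj_row_free => w wA0.
apply/eqP/negPn/negP => /posA.
by rewrite wA0 mul0mx mxE ltxx.
Qed.

Lemma fiber_coord_linear (R : realType) (n : nat) (b : 'I_n) (t : R)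
    (u z : 'rV[R]_n * 'rV[R]_n) :
  (t *: u + z).2 0 b = t * u.2 0 b + z.2 0 b.
Proof. by rewrite !mxE. Qed.

Lemma smooth_on_fiber_coord (R : realType) (n : nat)
    (D : set ('rV[R]_n * 'rV[R]_n)) (b : 'I_n) :
  smooth_on D (fun z => z.2 0 b : R^o).
Proof.
apply: smooth_on_linear => [z|t u y]; last exact: fiber_coord_linear.
apply: (@continuous_comp _ _ _ snd (fun y : 'rV[R]_n => y 0 b)).
  exact: cvg_snd.
exact: coord_continuous.
Qed.

Section LocalFinsler.
Variables (R : realType) (n : nat) (U : set 'rV[R]_n).
Local Notation TU := ('rV[R]_n * 'rV[R]_n)%type.
Variable F : TU -> R.
Local Notation D := (U `*` @slit R n).
Implicit Types (h : TU -> R^o) (z : TU).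
Hypothesis openU : open U.
Hypothesis smoothF : smooth_on D (F : TU -> R^o).
Hypothesis homogF : forall (x y : 'rV[R]_n) (c : R),
  U x -> 0 < c -> F (x, c *: y) = c * F (x, y).
Hypothesis posdefF : forall x y w : 'rV[R]_n, U x -> y != 0 -> w != 0 ->
  0 < (w *m fund F (x, y) *m w^T) 0 0.

Let openD : open D := open_slit_bundle openU.

Lemma smooth_on_dy k h : smooth_on D h -> smooth_on D (dy k h : TU -> R^o).
Proof. exact: smooth_on_derive. Qed.

Lemma smooth_on_sqF : smooth_on D (sqF F : TU -> R^o).
Proof.
have := smooth_onM openD smoothF smoothF.
by apply: (smooth_on_eq openD) => z _; rewrite /sqF expr2.
Qed.

Lemma smooth_on_fund i j : smooth_on D (fun z => fund F z i j : R^o).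
Proof.
have s := smooth_on_dy j (smooth_on_dy i smooth_on_sqF).
have := smooth_onM openD (smooth_on_cst (2^-1 : R^o)) s.
by apply: (smooth_on_eq openD) => z _; rewrite mxE.
Qed.

Lemma fund_unitmx z : D z -> fund F z \in unitmx.
Proof.
case: z => x y [/= Ux y0]; apply: posdef_unitmx => w w0.
exact: posdefF.
Qed.

Lemma smooth_on_fund_inv i j : smooth_on D (fun z => fund_inv F z i j : R^o).
Proof.
rewrite /fund_inv.
exact (@smooth_on_invmx _ _ _ openD n (fund F) i j smooth_on_fund fund_unitmx).
Qed.

Lemma fund_sym z i j : D z -> fund F z i j = fund F z j i.
Proof.
move=> Dz; rewrite [LHS]mxE [RHS]mxE /dy; apply: f_equal.
exact (derive_comm openD _ _ smooth_on_sqF Dz).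
Qed.

Lemma fund_inv_sym z i j : D z -> fund_inv F z i j = fund_inv F z j i.
Proof.
move=> Dz; have trF : (fund F z)^T = fund F z.
  by apply/matrixP => k l; rewrite mxE fund_sym.
have : (fund_inv F z)^T = fund_inv F z by rewrite /fund_inv trmx_inv trF.
by move/matrixP/(_ j i); rewrite mxE.
Qed.

(** Differentiate F^2(x, c y) = c^2 F^2(x, y) in y and cancel one factor c. *)
Lemma dy_sqF_homog z a (c : R) : D z -> 0 < c ->
  dy a (sqF F) (z.1, c *: z.2) = c * dy a (sqF F) z.
Proof.
move=> Dz c0; have [Ux y0] := Dz.
pose L (w : TU) : TU := (w.1, c *: w.2).
have linL (t : R) (v w : TU) : L (t *: v + w) = t *: L v + L w.
  by congr pair; rewrite /= scalerDr !scalerA mulrC.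
pose e : TU := (0, delta_mx 0 a).
have DL : D (L z) by split => //=; rewrite /slit /= scaler_eq0 negb_or (gt_eqF c0).
have E : 'D_e ((sqF F : TU -> R^o) \o L) z = c ^+ 2 * dy a (sqF F) z.
  rewrite -(derive_mulcE _ _ smooth_on_sqF Dz).
  apply: (derive_eq_on openD _ _ Dz) => w [Uw _].
  by rewrite /sqF /L /= homogF// -surjective_pairing exprMn.
rewrite derive_comp_linear// in E.
have Le : L e = c *: e by congr pair; rewrite /= scaler0.
rewrite Le (derive_dirZ _ c smooth_on_sqF DL) expr2 -mulrA in E.
exact: (mulfI (lt0r_neq0 c0)) E.
Qed.

(** Euler's identity for the 1-homogeneous function h = (F^2)_{y^a}: its radial derivative is h
    itself, and its fibre partial derivatives are 2 g_{ab}. *)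
Lemma dy_sqF z a : D z -> dy a (sqF F) z = 2 * lower_y F a z.
Proof.
move=> Dz; have [Ux y0] := Dz.
pose h : TU -> R^o := dy a (sqF F).
have sh : smooth_on D h := smooth_on_dy a smooth_on_sqF.
pose k (t : R) : R^o := h (t *: ((0, z.2) : TU) + z).
have kE (t : R) : k (t *: 1 + 0) = h (t *: ((0, z.2) : TU) + z).
  by rewrite /k addr0 [_%:A]mulr1.
pose k' (t : R) : R^o := t * h z.
have k'lin (t u y : R) : k' (t *: u + y) = t * k' u + k' y.
  by rewrite /k' mulrDl mulrA.
have E : 'D_((0, z.2) : TU) h z = h z.
  rewrite -(derive_line kE).
  (* Homogeneity needs a positive factor. Near t = 0 one has t + 1 > 0, hence h(x, (t + 1) y) = (t +
     1) h(x, y), which is affine in t. *)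
  transitivity ('D_1 (k' + cst (h z)) (0 : R)).
    apply: near_eq_derive; near=> t.
    have t1 : 0 < t + 1.
      rewrite -ltrBlDr sub0r; near: t.
      by apply: lt_nbhsr; rewrite ltrN10.
    rewrite /k /k' /h; transitivity ((t + 1) * h z); last first.
      by rewrite mulrDl mul1r.
    rewrite -dy_sqF_homog//; congr (dy a (sqF F) _).
    by congr pair; rewrite /= ?scaler0 ?add0r// scalerDl scale1r.
  have [d e] := @is_derive_linear _ R k' 0 1 k'lin.
  rewrite (deriveD d (derivable_cst _ _ _)) derive_cst addr0 e /k'.
  exact: mul1r.
have zE : ((0, z.2) : TU) = \sum_(b < n) z.2 0 b *: ((0, delta_mx 0 b) : TU).
  rewrite [z.2 in LHS]row_sum_delta; elim/big_rec2 : _ => // i u1 u2 _ <-.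
  by congr pair; rewrite /= scaler0 add0r.
rewrite -[LHS]E zE (derive_dir_sum openD _ _ sh Dz) /lower_y mulr_sumr.
apply: eq_bigr => b _; rewrite mxE -/(dy b h z) -/h.
by rewrite mulrA mulrA divff ?pnatr_eq0// mul1r mulrC.
Unshelve. all: by end_near. Qed.

Lemma smooth_on_lower_y a : smooth_on D (lower_y F a : TU -> R^o).
Proof.
apply: (smooth_on_sum openD) => b; apply: (smooth_onM openD).
  exact: smooth_on_fund.
exact: smooth_on_fiber_coord.
Qed.

(** By Euler's identity y_a is half of (F^2)_{y^a}. Differentiating this form, and not g_{ab} y^b,
    avoids the term C_{abl} y^b. *)
Lemma dy_lower_y z a l : D z -> dy l (lower_y F a) z = fund F z a l.
Proof.
move=> Dz; rewrite mxE -(derive_mulcE _ _ (smooth_on_dy a smooth_on_sqF) Dz).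
apply: (derive_eq_on openD _ _ Dz) => w Dw.
by rewrite dy_sqF// mulrA mulVf ?pnatr_eq0// mul1r.
Qed.

Lemma dy_fund z a b l : dy l (fun w => fund F w a b) z = 2 * cartan F a b l z.
Proof. by rewrite /cartan mulrA divff ?pnatr_eq0// mul1r. Qed.

Lemma cartan_sym z a b l : D z -> cartan F a b l z = cartan F b a l z.
Proof.
move=> Dz; congr (_ * _); apply: (derive_eq_on openD _ _ Dz) => w Dw.
exact: fund_sym.
Qed.

(** This is the derivative of an inverse matrix; the symmetry of g^{-1} brings the indices into the
    order used by [cartan_up]. *)
Lemma dy_fund_inv z c nu b : D z ->
  dy b (fun w => fund_inv F w c nu) z = - 2 * cartan_up F c nu b z.
Proof.
move=> Dz; rewrite [LHS](@derive_invmx _ _ _ openD n (fund F) c nu z _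
  smooth_on_fund fund_unitmx Dz).
rewrite mulNr; congr (- _); rewrite mulr_sumr; apply: eq_bigr => m _.
rewrite mulr_sumr; apply: eq_bigr => k _.
rewrite -/(fund_inv F z) (fund_inv_sym k nu Dz).
rewrite -[X in _ * X * _]/(dy b (fun w => fund F w m k) z) dy_fund.
by rewrite mulrCA -mulrA mulrAC -mulrA; congr (_ * _); rewrite mulrCA.
Qed.

(** Read this way, C^{c nu}_b is a fibre derivative: its smoothness and the symmetry of C^{c
    nu}_{b;a} in a and b follow from those of the derivatives of g^{c nu}. *)
Lemma cartan_upE z c nu b : D z -> cartan_up F c nu b z =
  - 2^-1 * dy b (fun w => fund_inv F w c nu) z.
Proof.
by move=> Dz; rewrite dy_fund_inv// mulrA mulrNN mulVf ?mul1r// pnatr_eq0.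
Qed.

Lemma smooth_on_cartan_up c nu b : smooth_on D (cartan_up F c nu b : TU -> R^o).
Proof.
have := smooth_onM openD (smooth_on_cst (- 2^-1 : R^o))
  (smooth_on_dy b (smooth_on_fund_inv c nu)).
by apply: (smooth_on_eq openD) => z Dz; rewrite cartan_upE.
Qed.

Lemma dy_cartan_up_sym z c nu a l : D z ->
  dy l (cartan_up F c nu a) z = dy a (cartan_up F c nu l) z.
Proof.
move=> Dz; have s := smooth_on_fund_inv c nu.
have E a' l' : dy l' (cartan_up F c nu a') z =
    - 2^-1 * dy l' (dy a' (fun w => fund_inv F w c nu)) z.
  rewrite -(derive_mulcE _ _ (smooth_on_dy a' s) Dz).
  by apply: (derive_eq_on openD _ _ Dz) => w Dw; rewrite cartan_upE.
rewrite (E a l) (E l a) /dy; apply: f_equal.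
exact (derive_comm openD _ _ s Dz).
Qed.

Lemma dy_add (h1 h2 : TU -> R) z l :
  smooth_on D (h1 : TU -> R^o) -> smooth_on D (h2 : TU -> R^o) -> D z ->
  dy l (fun w => h1 w + h2 w) z = dy l h1 z + dy l h2 z.
Proof. exact: derive_addE. Qed.

Lemma dy_mul (h1 h2 : TU -> R) z l :
  smooth_on D (h1 : TU -> R^o) -> smooth_on D (h2 : TU -> R^o) -> D z ->
  dy l (fun w => h1 w * h2 w) z = dy l h1 z * h2 z + h1 z * dy l h2 z.
Proof. exact: derive_mulE. Qed.

Lemma dy_mulc (c : R) (h : TU -> R) z l : smooth_on D (h : TU -> R^o) -> D z ->
  dy l (fun w => c * h w) z = c * dy l h z.
Proof. exact: derive_mulcE. Qed.

Lemma dy_eq_on (h1 h2 : TU -> R) z l : (forall w, D w -> h1 w = h2 w) -> D z ->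
  dy l h1 z = dy l h2 z.
Proof. exact: derive_eq_on. Qed.

Lemma dy_comm (h : TU -> R) z a b : smooth_on D (h : TU -> R^o) -> D z ->
  dy b (dy a h) z = dy a (dy b h) z.
Proof. by move=> sh Dz; exact (derive_comm openD _ _ sh Dz). Qed.

Lemma smooth_on_spray i : smooth_on D (spray F i : TU -> R^o).
Proof.
apply: (smooth_onM openD); first exact: smooth_on_cst.
apply: (smooth_on_sum openD) => l; apply: (smooth_onM openD).
  exact: smooth_on_fund_inv.
have sdx k h : smooth_on D h -> smooth_on D (dx k h : TU -> R^o).
  exact: smooth_on_derive.
have s1 : smooth_on D (fun z => \sum_(k < n) dx k (dy l (sqF F)) z * z.2 0 k : R^o).
  apply: (smooth_on_sum openD) => k; apply: (smooth_onM openD).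
    by apply/sdx/smooth_on_dy; exact: smooth_on_sqF.
  exact: smooth_on_fiber_coord.
have s2 := smooth_onM openD (smooth_on_cst (-1 : R^o)) (sdx l _ smooth_on_sqF).
have := smooth_onD openD s1 s2; apply: (smooth_on_eq openD) => z _.
by rewrite mulN1r.
Qed.

(* [G], [S], [C], [v], [g], [K] stand for g^{c nu}, F^2, C^{c nu}_b, v_a, g_{ab}
   and C_{abc}. *)
Lemma dy3_product (G S : TU -> R) (C v : 'I_n -> TU -> R)
    (g : 'I_n -> 'I_n -> TU -> R) (K : 'I_n -> 'I_n -> 'I_n -> TU -> R) z a b l :
  smooth_on D (G : TU -> R^o) -> smooth_on D (S : TU -> R^o) ->
  (forall k, smooth_on D (C k : TU -> R^o)) ->
  (forall k, smooth_on D (v k : TU -> R^o)) ->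
  (forall i j, smooth_on D (g i j : TU -> R^o)) ->
  (forall k w, D w -> dy k G w = - 2 * C k w) ->
  (forall k w, D w -> dy k S w = 2 * v k w) ->
  (forall i j w, D w -> dy j (v i) w = g i j w) ->
  (forall i j k w, dy k (g i j) w = 2 * K i j k w) ->
  (forall i j w, D w -> g i j w = g j i w) ->
  (forall i j k w, D w -> K i j k w = K j i k w) ->
  (forall i j w, D w -> dy j (C i) w = dy i (C j) w) -> D z ->
  dy l (dy b (dy a (fun w => G w * S w))) z =
  - 2 * (dy l (dy a (C b)) z * S z + 2 * dy a (C b) z * v l z
         + 2 * dy a (C l) z * v b z + 2 * C a z * g l b z
         + 2 * dy l (C b) z * v a z + 2 * C b z * g l a z
         + 2 * C l z * g a b z - 2 * G z * K a b l z).
Proof.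
move=> sG sS sC sv sg dG dS dv dg gsym Ksym Csym Dz.
have sM (h1 h2 : TU -> R) : smooth_on D (h1 : TU -> R^o) ->
    smooth_on D (h2 : TU -> R^o) ->
    smooth_on D ((fun w => h1 w * h2 w : R) : TU -> R^o).
  by move=> s1 s2; exact (smooth_onM openD s1 s2).
have sP (h1 h2 : TU -> R) : smooth_on D (h1 : TU -> R^o) ->
    smooth_on D (h2 : TU -> R^o) ->
    smooth_on D ((fun w => h1 w + h2 w : R) : TU -> R^o).
  by move=> s1 s2; exact (smooth_onD openD s1 s2).
have sc (k : R) (h : TU -> R) : smooth_on D (h : TU -> R^o) ->
    smooth_on D ((fun w => k * h w : R) : TU -> R^o).
  by move=> sh; exact (sM (fun=> k) h (smooth_on_cst (k : R^o)) sh).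
have sdC : smooth_on D (dy a (C b) : TU -> R^o) := smooth_on_dy a (sC b).
have sGS := sM _ _ sG sS.
have E1 w : D w -> dy b (fun w => G w * S w) w =
    - 2 * (C b w * S w) + 2 * (G w * v b w).
  move=> Dw; rewrite (dy_mul _ sG sS Dw) (dG _ _ Dw) (dS _ _ Dw).
  by rewrite -mulrA (mulrCA (G w)).
(* The derivative in b is taken first, so that the mixed term comes out as [dy a (C b)], the order
   used in the statement. *)
have E2 w : D w -> dy b (dy a (fun w => G w * S w)) w =
    - 2 * (dy a (C b) w * S w) + - 4 * (C b w * v a w)
    + (- 4 * (C a w * v b w) + 2 * (G w * g b a w)).
  move=> Dw; rewrite (dy_comm _ _ sGS Dw) (dy_eq_on _ E1 Dw).
  have s1 := sM _ _ (sC b) sS; have s2 := sM _ _ sG (sv b).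
  rewrite (dy_add _ (sc _ _ s1) (sc _ _ s2) Dw).
  rewrite (dy_mulc _ _ s1 Dw) (dy_mulc _ _ s2 Dw).
  rewrite (dy_mul _ (sC b) sS Dw) (dy_mul _ sG (sv b) Dw).
  rewrite (dG _ _ Dw) (dS _ _ Dw) (dv _ _ _ Dw).
  move: (dy a (C b) w) (C a w) (C b w) (S w) (v a w) (v b w) (G w) (g b a w).
  by move=> *; ring.
rewrite (dy_eq_on _ E2 Dz).
have s1 := sM _ _ sdC sS; have s2 := sM _ _ (sC b) (sv a).
have s3 := sM _ _ (sC a) (sv b); have s4 := sM _ _ sG (sg b a).
rewrite (dy_add _ (sP _ _ (sc (-2) _ s1) (sc (-4) _ s2))
  (sP _ _ (sc (-4) _ s3) (sc 2 _ s4)) Dz).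
rewrite (dy_add _ (sc (-2) _ s1) (sc (-4) _ s2) Dz).
rewrite (dy_add _ (sc (-4) _ s3) (sc 2 _ s4) Dz).
rewrite (dy_mulc _ _ s1 Dz) (dy_mulc _ _ s2 Dz) (dy_mulc _ _ s3 Dz).
rewrite (dy_mulc _ _ s4 Dz).
rewrite (dy_mul _ sdC sS Dz) (dy_mul _ (sC b) (sv a) Dz).
rewrite (dy_mul _ (sC a) (sv b) Dz) (dy_mul _ sG (sg b a) Dz).
rewrite (dG _ _ Dz) (dS _ _ Dz) (dv _ _ _ Dz) (dv _ _ _ Dz) dg.
(* Up to arithmetic, both sides now differ only in the order of indices. *)
rewrite (Ksym b a l z Dz) (Csym a l z Dz).
rewrite (gsym l b z Dz) (gsym l a z Dz) (gsym b a z Dz).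
move: (dy l (dy a (C b)) z) (dy a (C b) z) (dy a (C l) z) (dy l (C b) z).
move: (C a z) (C b z) (C l z) (S z) (v a z) (v b z) (v l z).
move: (g b l z) (g a l z) (g a b z) (G z) (K a b l z).
by move=> *; ring.
Qed.

Lemma dy3_fund_inv_sqF z c nu a b l : D z ->
  dy l (dy b (dy a (fun w => fund_inv F w c nu * sqF F w))) z =
  - 2 * (dy l (dy a (cartan_up F c nu b)) z * F z ^+ 2
         + 2 * dy a (cartan_up F c nu b) z * lower_y F l z
         + 2 * dy a (cartan_up F c nu l) z * lower_y F b z
         + 2 * cartan_up F c nu a z * fund F z l b
         + 2 * dy l (cartan_up F c nu b) z * lower_y F a z
         + 2 * cartan_up F c nu b z * fund F z l a
         + 2 * cartan_up F c nu l z * fund F z a b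
         - 2 * fund_inv F z c nu * cartan F a b l z).
Proof.
move=> Dz.
exact (@dy3_product (fun w => fund_inv F w c nu) (sqF F) (cartan_up F c nu)
  (lower_y F) (fun i j w => fund F w i j) (cartan F) z a b l
  (smooth_on_fund_inv c nu) smooth_on_sqF (smooth_on_cartan_up c nu)
  smooth_on_lower_y smooth_on_fund (fun k w => @dy_fund_inv w c nu k)
  (fun k w => @dy_sqF w k) (fun i j w => @dy_lower_y w i j)
  (fun i j k w => @dy_fund w i j k) (fun i j w => @fund_sym w i j)
  (fun i j k w => @cartan_sym w i j k)
  (fun i j w => @dy_cartan_up_sym w c nu i j) Dz).
Qed.

End LocalFinsler.

(** * Twisted products in a chart *)

Section ProductBundle.
Variables (R : realType) (n1 n2 : nat).
Local Notation TU n := ('rV[R]_n * 'rV[R]_n)%type.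
Local Notation TN := (TU (n1 + n2)).

Definition bproj1 (z : TN) : TU n1 := (lsubmx z.1, lsubmx z.2).
Definition bproj2 (z : TN) : TU n2 := (rsubmx z.1, rsubmx z.2).

Lemma bproj1_linear (t : R) (v z : TN) :
  bproj1 (t *: v + z) = t *: bproj1 v + bproj1 z.
Proof. by rewrite /bproj1 /= !linearP. Qed.

Lemma bproj2_linear (t : R) (v z : TN) :
  bproj2 (t *: v + z) = t *: bproj2 v + bproj2 z.
Proof. by rewrite /bproj2 /= !linearP. Qed.

Lemma bproj1_continuous : continuous bproj1.
Proof.
move=> z; apply: (@cvg_pair _ _ _ _ (nbhs _) (nbhs _)).
  apply: (@continuous_comp _ _ _ fst lsubmx); first exact: cvg_fst.
  exact: continuous_lsubmx.
apply: (@continuous_comp _ _ _ snd lsubmx); first exact: cvg_snd.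
exact: continuous_lsubmx.
Qed.

Lemma bproj2_continuous : continuous bproj2.
Proof.
move=> z; apply: (@cvg_pair _ _ _ _ (nbhs _) (nbhs _)).
  apply: (@continuous_comp _ _ _ fst rsubmx); first exact: cvg_fst.
  exact: continuous_rsubmx.
apply: (@continuous_comp _ _ _ snd rsubmx); first exact: cvg_snd.
exact: continuous_rsubmx.
Qed.

Lemma lsubmx_delta_lshift (i : 'I_n1) :
  lsubmx (delta_mx 0 (lshift n2 i) : 'rV[R]_(n1 + n2)) = delta_mx 0 i.
Proof. by apply/rowP => j; rewrite !mxE !eqxx (inj_eq (@lshift_inj _ _)). Qed.

Lemma rsubmx_delta_lshift (i : 'I_n1) :
  rsubmx (delta_mx 0 (lshift n2 i) : 'rV[R]_(n1 + n2)) = 0.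
Proof. by apply/rowP => j; rewrite !mxE eq_rlshift. Qed.

Lemma lsubmx_delta_rshift (a : 'I_n2) :
  lsubmx (delta_mx 0 (rshift n1 a) : 'rV[R]_(n1 + n2)) = 0.
Proof. by apply/rowP => j; rewrite !mxE eq_lrshift. Qed.

Lemma rsubmx_delta_rshift (a : 'I_n2) :
  rsubmx (delta_mx 0 (rshift n1 a) : 'rV[R]_(n1 + n2)) = delta_mx 0 a.
Proof. by apply/rowP => j; rewrite !mxE !eqxx (inj_eq (@rshift_inj _ _)). Qed.

Lemma dy_lshift_bproj1 (h : TU n1 -> R) i z :
  dy (lshift n2 i) (h \o bproj1) z = dy i h (bproj1 z).
Proof.
rewrite /dy (derive_comp_linear bproj1_linear (h : _ -> R^o)).
by rewrite /bproj1 /= linear0 lsubmx_delta_lshift.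
Qed.

Lemma dy_rshift_bproj1 (h : TU n1 -> R) a z :
  dy (rshift n1 a) (h \o bproj1) z = 0.
Proof.
rewrite /dy (derive_comp_linear bproj1_linear (h : _ -> R^o)).
by rewrite /bproj1 /= linear0 lsubmx_delta_rshift derive0.
Qed.

Lemma dy_lshift_bproj2 (h : TU n2 -> R) i z :
  dy (lshift n2 i) (h \o bproj2) z = 0.
Proof.
rewrite /dy (derive_comp_linear bproj2_linear (h : _ -> R^o)).
by rewrite /bproj2 /= linear0 rsubmx_delta_lshift derive0.
Qed.

Lemma dy_rshift_bproj2 (h : TU n2 -> R) a z :
  dy (rshift n1 a) (h \o bproj2) z = dy a h (bproj2 z).
Proof.
rewrite /dy (derive_comp_linear bproj2_linear (h : _ -> R^o)).
by rewrite /bproj2 /= linear0 rsubmx_delta_rshift.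
Qed.

Lemma dx_lshift_bproj1 (h : TU n1 -> R) i z :
  dx (lshift n2 i) (h \o bproj1) z = dx i h (bproj1 z).
Proof.
rewrite /dx (derive_comp_linear bproj1_linear (h : _ -> R^o)).
by rewrite /bproj1 /= linear0 lsubmx_delta_lshift.
Qed.

Lemma dx_rshift_bproj1 (h : TU n1 -> R) a z :
  dx (rshift n1 a) (h \o bproj1) z = 0.
Proof.
rewrite /dx (derive_comp_linear bproj1_linear (h : _ -> R^o)).
by rewrite /bproj1 /= linear0 lsubmx_delta_rshift derive0.
Qed.

Lemma dx_lshift_bproj2 (h : TU n2 -> R) i z :
  dx (lshift n2 i) (h \o bproj2) z = 0.
Proof.
rewrite /dx (derive_comp_linear bproj2_linear (h : _ -> R^o)).
by rewrite /bproj2 /= linear0 rsubmx_delta_lshift derive0.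
Qed.

Lemma dx_rshift_bproj2 (h : TU n2 -> R) a z :
  dx (rshift n1 a) (h \o bproj2) z = dx a h (bproj2 z).
Proof.
rewrite /dx (derive_comp_linear bproj2_linear (h : _ -> R^o)).
by rewrite /bproj2 /= linear0 rsubmx_delta_rshift.
Qed.

Lemma dx_base n (h : 'rV[R]_n -> R) i (z : TU n) :
  dx i (h \o fst) z = 'D_(delta_mx 0 i) (h : _ -> R^o) z.1.
Proof. exact: (derive_comp_linear (L := fst) _ (h : _ -> R^o)). Qed.

Lemma dy_base n (h : 'rV[R]_n -> R) i (z : TU n) : dy i (h \o fst) z = 0.
Proof.
rewrite /dy (derive_comp_linear (L := fst) _ (h : _ -> R^o))//=.
exact: derive0.
Qed.

End ProductBundle.

(** * Fundamental tensor, spray and Berwald curvature of the twisted metric *)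

Section TwistedLocal.
Variables (R : realType) (n1 n2 : nat).
Variables (U1 : set 'rV[R]_n1) (U2 : set 'rV[R]_n2).
Local Notation TU n := ('rV[R]_n * 'rV[R]_n)%type.
Local Notation TN := (TU (n1 + n2)).
Variables (F1 : TU n1 -> R) (F2 : TU n2 -> R) (T : TN -> R).
(** [k] is f read in a chart of the product. [T] is known through [sqT] only, so the square root is
    never differentiated. *)
Variable k : 'rV[R]_(n1 + n2) -> R.
Local Notation D1 := (U1 `*` @slit R n1).
Local Notation D2 := (U2 `*` @slit R n2).
Let U : set 'rV[R]_(n1 + n2) := [set x | U1 (lsubmx x) /\ U2 (rsubmx x)].
Let D : set TN := [set z | D1 (bproj1 z) /\ D2 (bproj2 z)].

Hypotheses (openU1 : open U1) (openU2 : open U2).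
Hypothesis smoothF1 : smooth_on D1 (F1 : _ -> R^o).
Hypothesis smoothF2 : smooth_on D2 (F2 : _ -> R^o).
Hypothesis homogF2 : forall (x y : 'rV[R]_n2) (c : R),
  U2 x -> 0 < c -> F2 (x, c *: y) = c * F2 (x, y).
Hypothesis posdefF1 : forall x y w : 'rV[R]_n1, U1 x -> y != 0 -> w != 0 ->
  0 < (w *m fund F1 (x, y) *m w^T) 0 0.
Hypothesis posdefF2 : forall x y w : 'rV[R]_n2, U2 x -> y != 0 -> w != 0 ->
  0 < (w *m fund F2 (x, y) *m w^T) 0 0.
Hypothesis smoothk : smooth_on U (k : _ -> R^o).
Hypothesis k_gt0 : forall x, 0 < k x.
Hypothesis k_const : forall i x, U x ->
  'D_(delta_mx 0 (lshift n2 i)) (k : _ -> R^o) x = 0.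
Hypothesis sqT : forall z,
  sqF T z = sqF F1 (bproj1 z) + k z.1 ^+ 2 * sqF F2 (bproj2 z).

Let dk (a : 'I_n2) (x : 'rV[R]_(n1 + n2)) : R :=
  'D_(delta_mx 0 (rshift n1 a)) (k : _ -> R^o) x.

Let openD : open D.
Proof.
have -> : D = @bproj1 R n1 n2 @^-1` D1 `&` @bproj2 R n1 n2 @^-1` D2 by [].
apply: openI; apply: open_comp.
- by move=> z _; exact: bproj1_continuous.
- exact: open_slit_bundle.
- by move=> z _; exact: bproj2_continuous.
- exact: open_slit_bundle.
Qed.

Let D_base z : D z -> U z.1.
Proof. by move=> [[? _] [? _]]. Qed.

Lemma smooth_on_bproj1 (h : TU n1 -> R) : smooth_on D1 (h : _ -> R^o) ->
  smooth_on D (h \o @bproj1 R n1 n2 : TN -> R^o).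
Proof.
apply: (smooth_on_comp_linear (@bproj1_linear R n1 n2) (@bproj1_continuous R n1 n2)).
by move=> z [].
Qed.

Lemma smooth_on_bproj2 (h : TU n2 -> R) : smooth_on D2 (h : _ -> R^o) ->
  smooth_on D (h \o @bproj2 R n1 n2 : TN -> R^o).
Proof.
apply: (smooth_on_comp_linear (@bproj2_linear R n1 n2) (@bproj2_continuous R n1 n2)).
by move=> z [].
Qed.

Lemma smooth_on_base (h : 'rV[R]_(n1 + n2) -> R) : smooth_on U (h : _ -> R^o) ->
  smooth_on D (h \o fst : TN -> R^o).
Proof.
have fst_linear (t : R) (v w : TN) : (t *: v + w).1 = t *: v.1 + w.1 by [].
apply: (smooth_on_comp_linear fst_linear); last exact: D_base.
by move=> z; exact: cvg_fst.
Qed.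

Lemma dy_mul_on (h1 h2 : TN -> R) z i : smooth_on D (h1 : _ -> R^o) ->
  smooth_on D (h2 : _ -> R^o) -> D z ->
  dy i (fun w => h1 w * h2 w) z = dy i h1 z * h2 z + h1 z * dy i h2 z.
Proof. exact: derive_mulE. Qed.

Lemma dx_mul_on (h1 h2 : TN -> R) z i : smooth_on D (h1 : _ -> R^o) ->
  smooth_on D (h2 : _ -> R^o) -> D z ->
  dx i (fun w => h1 w * h2 w) z = dx i h1 z * h2 z + h1 z * dx i h2 z.
Proof. exact: derive_mulE. Qed.

Lemma dy_add_on (h1 h2 : TN -> R) z i : smooth_on D (h1 : _ -> R^o) ->
  smooth_on D (h2 : _ -> R^o) -> D z ->
  dy i (fun w => h1 w + h2 w) z = dy i h1 z + dy i h2 z.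
Proof. exact: derive_addE. Qed.

Lemma dx_add_on (h1 h2 : TN -> R) z i : smooth_on D (h1 : _ -> R^o) ->
  smooth_on D (h2 : _ -> R^o) -> D z ->
  dx i (fun w => h1 w + h2 w) z = dx i h1 z + dx i h2 z.
Proof. exact: derive_addE. Qed.

Lemma dy_eq_onD (h1 h2 : TN -> R) z i : (forall w, D w -> h1 w = h2 w) -> D z ->
  dy i h1 z = dy i h2 z.
Proof. exact: derive_eq_on. Qed.

Lemma dx_eq_onD (h1 h2 : TN -> R) z i : (forall w, D w -> h1 w = h2 w) -> D z ->
  dx i h1 z = dx i h2 z.
Proof. exact: derive_eq_on. Qed.

Let openU : open U.
Proof.
have -> : U = lsubmx @^-1` U1 `&` rsubmx @^-1` U2 by [].
apply: openI; apply: open_comp => //.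
- by move=> x _; exact: continuous_lsubmx.
- by move=> x _; exact: continuous_rsubmx.
Qed.

Let phi (x : 'rV[R]_(n1 + n2)) : R := k x * k x.

Let smooth_phi : smooth_on U (phi : _ -> R^o).
Proof. exact: (smooth_onM openU smoothk smoothk). Qed.

(** Here the constancy of f on M1 acts: it removes the x-derivatives of f^2 from both components of
    the spray. *)
Let derive_phi_lshift i x : U x ->
  'D_(delta_mx 0 (lshift n2 i)) (phi : _ -> R^o) x = 0.
Proof.
move=> Ux; apply: etrans (derive_mulE _ smoothk smoothk Ux) _.
by rewrite k_const// mul0r mulr0 addr0.
Qed.

Let derive_phi_rshift a x : U x ->
  'D_(delta_mx 0 (rshift n1 a)) (phi : _ -> R^o) x = 2 * (k x * dk a x).
Proof.
move=> Ux; apply: etrans (derive_mulE _ smoothk smoothk Ux) _.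
have alg (u v : R) : u * v + v * u = 2 * (v * u) by ring.
exact: alg.
Qed.

(** The shape of F^2. Fibre derivatives preserve it: one along the first factor replaces h2 by 0,
    one along the second replaces h1 by 0. *)
Let twist (h1 : TU n1 -> R) (h2 : TU n2 -> R) (z : TN) : R :=
  h1 (bproj1 z) + phi z.1 * h2 (bproj2 z).

Let smooth_phi2 h2 : smooth_on D2 (h2 : _ -> R^o) ->
  smooth_on D ((fun z => (phi \o fst) z * (h2 \o @bproj2 R n1 n2) z : R) : TN -> R^o).
Proof.
move=> s2.
by exact (smooth_onM openD (smooth_on_base smooth_phi) (smooth_on_bproj2 s2)).
Qed.

Let dy_twist h1 h2 z i : smooth_on D1 (h1 : _ -> R^o) ->
  smooth_on D2 (h2 : _ -> R^o) -> D z ->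
  dy i (twist h1 h2) z =
  dy i (h1 \o @bproj1 R n1 n2) z + phi z.1 * dy i (h2 \o @bproj2 R n1 n2) z.
Proof.
move=> s1 s2 Dz.
rewrite (dy_add_on _ (smooth_on_bproj1 s1) (smooth_phi2 s2) Dz).
rewrite (dy_mul_on _ (smooth_on_base smooth_phi) (smooth_on_bproj2 s2) Dz).
by rewrite dy_base mul0r add0r.
Qed.

Let dx_twist h1 h2 z i : smooth_on D1 (h1 : _ -> R^o) ->
  smooth_on D2 (h2 : _ -> R^o) -> D z ->
  dx i (twist h1 h2) z =
  dx i (h1 \o @bproj1 R n1 n2) z +
  ('D_(delta_mx 0 i) (phi : _ -> R^o) z.1 * h2 (bproj2 z) +
   phi z.1 * dx i (h2 \o @bproj2 R n1 n2) z).
Proof.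
move=> s1 s2 Dz.
rewrite (dx_add_on _ (smooth_on_bproj1 s1) (smooth_phi2 s2) Dz).
rewrite (dx_mul_on _ (smooth_on_base smooth_phi) (smooth_on_bproj2 s2) Dz).
by rewrite dx_base.
Qed.

Let dy_twist_lshift h1 h2 z i : smooth_on D1 (h1 : _ -> R^o) ->
  smooth_on D2 (h2 : _ -> R^o) -> D z ->
  dy (lshift n2 i) (twist h1 h2) z = twist (dy i h1) (fun=> 0) z.
Proof.
by move=> s1 s2 Dz; rewrite (dy_twist _ s1 s2 Dz) dy_lshift_bproj1 dy_lshift_bproj2.
Qed.

Let dy_twist_rshift h1 h2 z a : smooth_on D1 (h1 : _ -> R^o) ->
  smooth_on D2 (h2 : _ -> R^o) -> D z ->
  dy (rshift n1 a) (twist h1 h2) z = twist (fun=> 0) (dy a h2) z.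
Proof.
by move=> s1 s2 Dz; rewrite (dy_twist _ s1 s2 Dz) dy_rshift_bproj1 dy_rshift_bproj2.
Qed.

Let dx_twist_lshift h1 h2 z i : smooth_on D1 (h1 : _ -> R^o) ->
  smooth_on D2 (h2 : _ -> R^o) -> D z ->
  dx (lshift n2 i) (twist h1 h2) z = dx i h1 (bproj1 z).
Proof.
move=> s1 s2 Dz; rewrite (dx_twist _ s1 s2 Dz) dx_lshift_bproj1 dx_lshift_bproj2.
by rewrite (derive_phi_lshift _ (D_base Dz)) mul0r mulr0 !addr0.
Qed.

Let dx_twist_rshift h1 h2 z a : smooth_on D1 (h1 : _ -> R^o) ->
  smooth_on D2 (h2 : _ -> R^o) -> D z ->
  dx (rshift n1 a) (twist h1 h2) z =
  2 * (k z.1 * dk a z.1) * h2 (bproj2 z) + phi z.1 * dx a h2 (bproj2 z).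
Proof.
move=> s1 s2 Dz; rewrite (dx_twist _ s1 s2 Dz) dx_rshift_bproj1 dx_rshift_bproj2.
by rewrite (derive_phi_rshift _ (D_base Dz)) add0r.
Qed.

Let sS1 : smooth_on D1 (sqF F1 : _ -> R^o) := smooth_on_sqF openU1 smoothF1.
Let sS2 : smooth_on D2 (sqF F2 : _ -> R^o) := smooth_on_sqF openU2 smoothF2.

Let sqTE : sqF T = twist (sqF F1) (sqF F2).
Proof. by apply/funext => z; rewrite sqT expr2. Qed.

Let s01 : smooth_on D1 ((fun=> 0 : R) : _ -> R^o) := smooth_on_cst (0 : R^o).
Let s02 : smooth_on D2 ((fun=> 0 : R) : _ -> R^o) := smooth_on_cst (0 : R^o).

Let dy0 n i (z : TU n) : dy i (fun=> 0 : R) z = 0.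
Proof. exact: derive_cst. Qed.

Let dx0 n i (z : TU n) : dx i (fun=> 0 : R) z = 0.
Proof. exact: derive_cst. Qed.

Let dy_sqT_lshift i z : D z ->
  dy (lshift n2 i) (sqF T) z = twist (dy i (sqF F1)) (fun=> 0) z.
Proof. by move=> Dz; rewrite sqTE (dy_twist_lshift _ sS1 sS2 Dz). Qed.

Let dy_sqT_rshift a z : D z ->
  dy (rshift n1 a) (sqF T) z = twist (fun=> 0) (dy a (sqF F2)) z.
Proof. by move=> Dz; rewrite sqTE (dy_twist_rshift _ sS1 sS2 Dz). Qed.

Let sdy1 i : smooth_on D1 (dy i (sqF F1) : _ -> R^o) := smooth_on_dy i sS1.
Let sdy2 a : smooth_on D2 (dy a (sqF F2) : _ -> R^o) := smooth_on_dy a sS2.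

Lemma twisted_fund z : D z -> fund T z =
  block_mx (fund F1 (bproj1 z)) 0 0 (phi z.1 *: fund F2 (bproj2 z)).
Proof.
move=> Dz; rewrite -[LHS]submxK; apply: (f_equal4 (@block_mx R n1 n2 n1 n2)).
- apply/matrixP => i j; rewrite 3![LHS]mxE [RHS]mxE.
  rewrite (dy_eq_onD _ (dy_sqT_lshift i) Dz) (dy_twist_lshift _ (sdy1 i) s02 Dz).
  by rewrite /twist mulr0 addr0.
- apply/matrixP => i a; rewrite 3![LHS]mxE [RHS]mxE.
  rewrite (dy_eq_onD _ (dy_sqT_lshift i) Dz) (dy_twist_rshift _ (sdy1 i) s02 Dz).
  by rewrite /twist dy0 mulr0 addr0 mulr0.
- apply/matrixP => a i; rewrite 3![LHS]mxE [RHS]mxE.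
  rewrite (dy_eq_onD _ (dy_sqT_rshift a) Dz) (dy_twist_lshift _ s01 (sdy2 a) Dz).
  by rewrite /twist dy0 mulr0 addr0 mulr0.
- apply/matrixP => a b; rewrite 3![LHS]mxE [RHS]mxE [fund F2 _ _ _]mxE.
  rewrite (dy_eq_onD _ (dy_sqT_rshift a) Dz) (dy_twist_rshift _ s01 (sdy2 a) Dz).
  by rewrite /twist add0r mulrCA.
Qed.

Lemma twisted_fund_inv z : D z -> fund_inv T z =
  block_mx (fund_inv F1 (bproj1 z)) 0 0
           ((phi z.1)^-1 *: fund_inv F2 (bproj2 z)).
Proof.
move=> Dz; have [Dz1 Dz2] := Dz.
have phi0 : phi z.1 != 0 by rewrite mulf_neq0 ?lt0r_neq0.
have u1 := fund_unitmx posdefF1 Dz1; have u2 := fund_unitmx posdefF2 Dz2.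
have u3 : phi z.1 *: fund F2 (bproj2 z) \in unitmx by rewrite unitmxZ ?unitfE.
rewrite /fund_inv (twisted_fund Dz) invmx_block_diag.
  by rewrite invmxZ.
rewrite unitmxE det_ublock unitrM -!unitmxE u1 u3//.
Qed.

Lemma twisted_spray_lshift z i : D z ->
  spray T (lshift n2 i) z = spray F1 i (bproj1 z).
Proof.
move=> Dz; rewrite /spray (twisted_fund_inv Dz); apply: f_equal.
rewrite big_split_ord/= [X in _ + X]big1 ?addr0 => [|a _]; last first.
  by rewrite block_mxEur mxE mul0r.
apply: eq_bigr => l _; rewrite block_mxEul; apply: f_equal.
rewrite sqTE (dx_twist_lshift _ sS1 sS2 Dz); apply: (f_equal (fun x => x - _)).
rewrite -sqTE big_split_ord/= [X in _ + X]big1 ?addr0 => [|a _]; last first.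
  rewrite (dx_eq_onD _ (dy_sqT_lshift l) Dz) (dx_twist_rshift _ (sdy1 l) s02 Dz).
  by rewrite dx0 !mulr0 addr0 mul0r.
apply: eq_bigr => j _.
rewrite (dx_eq_onD _ (dy_sqT_lshift l) Dz) (dx_twist_lshift _ (sdy1 l) s02 Dz).
by rewrite /= mxE.
Qed.

Lemma twisted_spray_rshift z a : D z ->
  spray T (rshift n1 a) z = spray F2 a (bproj2 z) +
  \sum_(nu < n2) ((k z.1)^-1 * dk nu z.1) *
    ((bproj2 z).2 0 nu * (bproj2 z).2 0 a
     - 2^-1 * (fund_inv F2 (bproj2 z) a nu * sqF F2 (bproj2 z))).
Proof.
move=> Dz; have [Dz1 Dz2] := Dz; rewrite /spray (twisted_fund_inv Dz).
have k0 : k z.1 != 0 by rewrite lt0r_neq0.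
set w := bproj2 z.
pose S b := \sum_(c < n2) dx c (dy b (sqF F2)) w * w.2 0 c - dx b (sqF F2) w.
(* This is f^2 times the bracket in the spray of F2, plus the terms (f^2)_c v^c (F2^2)_{v^b} -
   (f^2)_b F2^2 in which f^2 is differentiated; Euler's identity rewrites (F2^2)_{v^b} as 2 v_b. *)
have E b : \sum_(j < n1 + n2) dx j (dy (rshift n1 b) (sqF T)) z * z.2 0 j -
    dx (rshift n1 b) (sqF T) z =
    phi z.1 * S b + 2 * k z.1 * ((\sum_(c < n2) dk c z.1 * w.2 0 c) *
      (2 * lower_y F2 b w) - dk b z.1 * sqF F2 w).
  rewrite -(dy_sqF openU2 smoothF2 homogF2 b Dz2).
  rewrite [in X in _ - X]sqTE (dx_twist_rshift _ sS1 sS2 Dz).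
  rewrite big_split_ord/= [X in X + _ - _]big1 ?add0r => [|i _]; last first.
    rewrite (dx_eq_onD _ (dy_sqT_rshift b) Dz).
    by rewrite (dx_twist_lshift _ s01 (sdy2 b) Dz) dx0 mul0r.
  have -> : \sum_(c < n2) dx (rshift n1 c) (dy (rshift n1 b) (sqF T)) z *
      z.2 0 (rshift n1 c) = phi z.1 * (\sum_(c < n2) dx c (dy b (sqF F2)) w * w.2 0 c)
      + 2 * k z.1 * ((\sum_(c < n2) dk c z.1 * w.2 0 c) * dy b (sqF F2) w).
    rewrite mulr_sumr mulr_suml mulr_sumr -big_split/=; apply: eq_bigr => c _.
    rewrite (dx_eq_onD _ (dy_sqT_rshift b) Dz).
    rewrite (dx_twist_rshift _ s01 (sdy2 b) Dz) -/w.
    have -> : z.2 0 (rshift n1 c) = w.2 0 c by rewrite [RHS]mxE.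
    move: (dx c (dy b (sqF F2)) w) (dy b (sqF F2) w) (phi z.1) (dk c z.1).
    by move: (w.2 0 c) (k z.1) => *; ring.
  rewrite /S -/w.
  move: (dx b (sqF F2) w) (dy b (sqF F2) w) (phi z.1) (dk b z.1) (sqF F2 w).
  move: (\sum_(c < n2) dk c z.1 * w.2 0 c) (k z.1).
  by move: (\sum_(c < n2) dx c (dy b (sqF F2)) w * w.2 0 c) => *; ring.
rewrite big_split_ord/= [X in X + _]big1 ?add0r => [|i _]; last first.
  by rewrite block_mxEdl mxE mul0r.
(* Raising the index of v_b is what turns the first extra term into v^nu v^a. *)
have inv_lower : \sum_(b < n2) fund_inv F2 w a b * lower_y F2 b w = w.2 0 a.
  have -> : \sum_(b < n2) fund_inv F2 w a b * lower_y F2 b w =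
      (fund_inv F2 w *m (fund F2 w *m w.2^T)) a 0.
    rewrite [RHS]mxE; apply: eq_bigr => b _; apply: f_equal.
    by rewrite [RHS]mxE; apply: eq_bigr => c _; rewrite [w.2^T _ _]mxE.
  by rewrite mulmxA mulVmx ?(fund_unitmx posdefF2 Dz2)// mul1mx mxE.
pose V := \sum_(c < n2) dk c z.1 * w.2 0 c.
have -> : \sum_(b < n2) block_mx (fund_inv F1 (bproj1 z)) 0 0
      ((phi z.1)^-1 *: fund_inv F2 w) (rshift n1 a) (rshift n1 b) *
      (\sum_(j < n1 + n2) dx j (dy (rshift n1 b) (sqF T)) z * z.2 0 j -
       dx (rshift n1 b) (sqF T) z) =
    \sum_(b < n2) fund_inv F2 w a b * S b +
    (2 * (k z.1)^-1) * (2 * V * (\sum_(b < n2) fund_inv F2 w a b * lower_y F2 b w)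
      - (\sum_(b < n2) fund_inv F2 w a b * dk b z.1) * sqF F2 w).
  rewrite mulr_sumr mulr_suml -sumrB mulr_sumr -big_split/=.
  apply: eq_bigr => b _; rewrite E block_mxEdr [X in X * _ = _]mxE /phi -/V.
  move: (fund_inv F2 w a b) (S b) (lower_y F2 b w) (dk b z.1) (sqF F2 w) V.
  by move: (k z.1) k0 => x x0 *; field.
rewrite inv_lower mulrDr; apply: f_equal.
have -> : 2 * V * w.2 0 a -
      (\sum_(b < n2) fund_inv F2 w a b * dk b z.1) * sqF F2 w =
    \sum_(nu < n2) dk nu z.1 * (2 * (w.2 0 nu * w.2 0 a) -
      fund_inv F2 w a nu * sqF F2 w).
  rewrite /V mulr_sumr !mulr_suml -sumrB; apply: eq_bigr => nu _.
  move: (fund_inv F2 w a nu) (dk nu z.1) (sqF F2 w) (w.2 0 nu) (w.2 0 a) => *.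
  by ring.
rewrite !mulr_sumr; apply: eq_bigr => nu _.
move: (fund_inv F2 w a nu) (dk nu z.1) (sqF F2 w) (w.2 0 nu) (w.2 0 a).
by move: (k z.1) k0 => x x0 *; field.
Qed.

(** The effect of the j-th fibre derivative of the product on a function pulled back from the first
    factor: [dy] or 0, according to the block of j. Keeping j undivided lets three derivatives be
    taken before any case analysis. *)
Let push1 j (h : TU n1 -> R) (w : TU n1) : R :=
  'D_(bproj1 ((0, delta_mx 0 j) : TN)) (h : _ -> R^o) w.
Let push2 j (h : TU n2 -> R) (w : TU n2) : R :=
  'D_(bproj2 ((0, delta_mx 0 j) : TN)) (h : _ -> R^o) w.

Let push1_lshift i h : push1 (lshift n2 i) h = dy i h.
Proof.
apply/funext => w; rewrite /push1 /dy.
by rewrite /bproj1 /= linear0 lsubmx_delta_lshift.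
Qed.

Let push1_rshift a h : push1 (rshift n1 a) h = fun=> 0.
Proof.
apply/funext => w; rewrite /push1.
by rewrite /bproj1 /= linear0 lsubmx_delta_rshift derive0.
Qed.

Let push2_lshift i h : push2 (lshift n2 i) h = fun=> 0.
Proof.
apply/funext => w; rewrite /push2.
by rewrite /bproj2 /= linear0 rsubmx_delta_lshift derive0.
Qed.

Let push2_rshift a h : push2 (rshift n1 a) h = dy a h.
Proof.
apply/funext => w; rewrite /push2 /dy.
by rewrite /bproj2 /= linear0 rsubmx_delta_rshift.
Qed.

Let push1_0 j : push1 j (fun=> 0) = fun=> 0.
Proof. by apply/funext => w; exact: derive_cst. Qed.

Let push2_0 j : push2 j (fun=> 0) = fun=> 0.
Proof. by apply/funext => w; exact: derive_cst. Qed.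

Let push1_comp j h z : dy j (h \o @bproj1 R n1 n2) z = (push1 j h \o @bproj1 R n1 n2) z.
Proof. exact: (derive_comp_linear (@bproj1_linear R n1 n2) (h : _ -> R^o)). Qed.

Let push2_comp j h z : dy j (h \o @bproj2 R n1 n2) z = (push2 j h \o @bproj2 R n1 n2) z.
Proof. exact: (derive_comp_linear (@bproj2_linear R n1 n2) (h : _ -> R^o)). Qed.

Let berwald_lshiftE z i j1 j2 j3 : D z -> berwald T (lshift n2 i) j1 j2 j3 z =
  push1 j3 (push1 j2 (push1 j1 (spray F1 i))) (bproj1 z).
Proof.
move=> Dz.
have E0 w : D w -> spray T (lshift n2 i) w = (spray F1 i \o @bproj1 R n1 n2) w.
  exact: twisted_spray_lshift.
have E1 w : D w -> dy j1 (spray T (lshift n2 i)) w =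
    (push1 j1 (spray F1 i) \o @bproj1 R n1 n2) w.
  by move=> Dw; rewrite (dy_eq_onD _ E0 Dw) push1_comp.
have E2 w : D w -> dy j2 (dy j1 (spray T (lshift n2 i))) w =
    (push1 j2 (push1 j1 (spray F1 i)) \o @bproj1 R n1 n2) w.
  by move=> Dw; rewrite (dy_eq_onD _ E1 Dw) push1_comp.
by rewrite /berwald (dy_eq_onD _ E2 Dz) push1_comp.
Qed.

Lemma twisted_berwald_lshift z i j1 j2 j3 : D z ->
  berwald T (lshift n2 i) (lshift n2 j1) (lshift n2 j2) (lshift n2 j3) z =
  berwald F1 i j1 j2 j3 (bproj1 z).
Proof. by move=> Dz; rewrite (berwald_lshiftE _ _ _ _ Dz) 3!push1_lshift. Qed.

Lemma twisted_berwald_lshift_eq0 z i j1 j2 j3 : D z ->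
  (forall j1 j2 j3, berwald F1 i j1 j2 j3 (bproj1 z) = 0) ->
  berwald T (lshift n2 i) j1 j2 j3 z = 0.
Proof.
move=> Dz B0; rewrite (berwald_lshiftE _ _ _ _ Dz).
case: (split_ordP j1) => i1 ->; last by rewrite push1_rshift !push1_0.
case: (split_ordP j2) => i2 ->; last by rewrite push1_rshift !push1_0.
case: (split_ordP j3) => i3 ->; last by rewrite push1_rshift.
by rewrite !push1_lshift; exact: B0.
Qed.

(** The logarithmic derivative of f along u^nu, a constant for fibre derivatives. *)
Let kap nu (x : 'rV[R]_(n1 + n2)) : R := (k x)^-1 * dk nu x.

Let smooth_kap nu : smooth_on U (kap nu : _ -> R^o).
Proof.
have k_neq0 x : U x -> k x != 0 by move=> _; rewrite lt0r_neq0.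
exact (smooth_onM openU (smooth_onV openU k_neq0 smoothk)
  (smooth_on_derive (delta_mx 0 (rshift n1 nu)) smoothk)).
Qed.

(** The shape of the second component of the spray. By [dy_comb] a fibre derivative acts on [H0] and
    on each [H nu] and leaves the coefficients alone. *)
Let comb (H0 : TU n2 -> R) (H : 'I_n2 -> TU n2 -> R) (z : TN) : R :=
  H0 (bproj2 z) + \sum_(nu < n2) kap nu z.1 * H nu (bproj2 z).

Let dy_comb H0 H j z : smooth_on D2 (H0 : _ -> R^o) ->
  (forall nu, smooth_on D2 (H nu : _ -> R^o)) -> D z ->
  dy j (comb H0 H) z = comb (push2 j H0) (fun nu => push2 j (H nu)) z.
Proof.
move=> s0 sH Dz.
have sk nu := smooth_on_base (smooth_kap nu).
have s2 nu := smooth_on_bproj2 (sH nu).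
have sM nu := smooth_onM openD (sk nu) (s2 nu).
have sS : smooth_on D ((fun w => \sum_(nu < n2) (kap nu \o fst) w *
    (H nu \o @bproj2 R n1 n2) w : R) : TN -> R^o).
  exact (smooth_on_sum openD (index_enum 'I_n2) predT sM).
have -> : comb H0 H = fun w => (H0 \o @bproj2 R n1 n2) w +
  \sum_(nu < n2) (kap nu \o fst) w * (H nu \o @bproj2 R n1 n2) w by [].
rewrite (dy_add_on _ (smooth_on_bproj2 s0) sS Dz) push2_comp /comb.
apply: f_equal; apply: etrans (derive_sumE _ sM Dz) _.
apply: eq_bigr => nu _; apply: etrans (dy_mul_on _ (sk nu) (s2 nu) Dz) _.
by rewrite dy_base push2_comp mul0r add0r.
Qed.

(** The factor of f^-1 f_nu in the spray, written as a sum with scalar - 1/2 to fit [dy3_linear]. *)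
Let W a nu (w : TU n2) : R := w.2 0 nu * w.2 0 a +
  - 2^-1 * (fund_inv F2 w a nu * sqF F2 w).

Let openD2 : open D2 := open_slit_bundle openU2.

Let smooth_quad a nu :
  smooth_on D2 ((fun w => w.2 0 nu * w.2 0 a : R) : TU n2 -> R^o).
Proof.
exact (smooth_onM openD2 (@smooth_on_fiber_coord R n2 D2 nu)
  (@smooth_on_fiber_coord R n2 D2 a)).
Qed.

Let smooth_GS a nu :
  smooth_on D2 ((fun w => fund_inv F2 w a nu * sqF F2 w : R) : TU n2 -> R^o).
Proof.
exact (smooth_onM openD2 (smooth_on_fund_inv openU2 smoothF2 posdefF2 a nu) sS2).
Qed.

Let smooth_W a nu : smooth_on D2 (W a nu : _ -> R^o).
Proof.
exact (smooth_onD openD2 (smooth_quad a nu)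
  (smooth_onM openD2 (smooth_on_cst (- 2^-1 : R^o)) (smooth_GS a nu))).
Qed.

Let berwald_rshiftE z c j1 j2 j3 : D z -> berwald T (rshift n1 c) j1 j2 j3 z =
  comb (push2 j3 (push2 j2 (push2 j1 (spray F2 c))))
       (fun nu => push2 j3 (push2 j2 (push2 j1 (W c nu)))) z.
Proof.
move=> Dz.
have s0 := smooth_on_spray openU2 smoothF2 posdefF2 c.
have sp j (h : TU n2 -> R) : smooth_on D2 (h : _ -> R^o) ->
  smooth_on D2 (push2 j h : _ -> R^o) by exact: smooth_on_derive.
have E0 w : D w -> spray T (rshift n1 c) w = comb (spray F2 c) (W c) w.
  move=> Dw; rewrite (twisted_spray_rshift _ Dw) /comb /W.
  by apply: f_equal; apply: eq_bigr => nu _; rewrite mulNr.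
have E1 w : D w -> dy j1 (spray T (rshift n1 c)) w =
    comb (push2 j1 (spray F2 c)) (fun nu => push2 j1 (W c nu)) w.
  by move=> Dw; rewrite (dy_eq_onD _ E0 Dw) (dy_comb _ s0 (smooth_W c) Dw).
have E2 w : D w -> dy j2 (dy j1 (spray T (rshift n1 c))) w =
    comb (push2 j2 (push2 j1 (spray F2 c)))
      (fun nu => push2 j2 (push2 j1 (W c nu))) w.
  move=> Dw; rewrite (dy_eq_onD _ E1 Dw).
  by rewrite (dy_comb _ (sp _ _ s0) (fun nu => sp _ _ (smooth_W c nu)) Dw).
rewrite /berwald (dy_eq_onD _ E2 Dz).
by rewrite (dy_comb _ (sp _ _ (sp _ _ s0)) (fun nu => sp _ _ (sp _ _ (smooth_W c nu))) Dz).
Qed.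

Let comb0 z : comb (fun=> 0) (fun nu => fun=> 0) z = 0.
Proof. by rewrite /comb add0r big1// => nu _; rewrite mulr0. Qed.

Let dy_coord b c (w : TU n2) : dy b (fun w => w.2 0 c) w = (delta_mx 0 b : 'rV[R]_n2) 0 c.
Proof.
have [_ E] := is_derive_linear w ((0, delta_mx 0 b) : TU n2)
  (@fiber_coord_linear R n2 c).
exact: E.
Qed.

Let dy3_quad c nu a b l w : D2 w ->
  dy l (dy b (dy a (fun w => w.2 0 nu * w.2 0 c))) w = 0.
Proof.
move=> Dw; pose e i j := (delta_mx 0 i : 'rV[R]_n2) 0 j.
have sx i : smooth_on D2 ((fun w => w.2 0 i : R) : TU n2 -> R^o).
  exact: smooth_on_fiber_coord.
have smx r i : smooth_on D2 ((fun w => r * w.2 0 i : R) : TU n2 -> R^o).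
  exact (smooth_onM openD2 (smooth_on_cst (r : R^o)) (sx i)).
have E1 u : D2 u -> dy a (fun w => w.2 0 nu * w.2 0 c) u =
    e a nu * u.2 0 c + e a c * u.2 0 nu.
  move=> Du; rewrite (dy_mul _ (sx nu) (sx c) Du) !dy_coord.
  by rewrite (mulrC (u.2 0 nu)).
have E2 u : D2 u -> dy b (dy a (fun w => w.2 0 nu * w.2 0 c)) u =
    e a nu * e b c + e a c * e b nu.
  move=> Du; rewrite (dy_eq_on openU2 _ E1 Du).
  rewrite (dy_add _ (smx _ _) (smx _ _) Du).
  by rewrite (dy_mulc _ _ (sx _) Du) (dy_mulc _ _ (sx _) Du) !dy_coord.
rewrite (dy_eq_on openU2 _ E2 Dw).
exact: derive_cst.
Qed.

Let dy3_linear (h1 h2 : TU n2 -> R) (r : R) a b l w : smooth_on D2 (h1 : _ -> R^o) ->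
  smooth_on D2 (h2 : _ -> R^o) -> D2 w ->
  dy l (dy b (dy a (fun u => h1 u + r * h2 u))) w =
  dy l (dy b (dy a h1)) w + r * dy l (dy b (dy a h2)) w.
Proof.
have E (g1 g2 : TU n2 -> R) i u : smooth_on D2 (g1 : _ -> R^o) ->
    smooth_on D2 (g2 : _ -> R^o) -> D2 u ->
    dy i (fun u => g1 u + r * g2 u) u = dy i g1 u + r * dy i g2 u.
  move=> s1 s2 Du.
  have s3 : smooth_on D2 ((fun u => r * g2 u : R) : TU n2 -> R^o).
    exact (smooth_onM openD2 (smooth_on_cst (r : R^o)) s2).
  by rewrite (dy_add _ s1 s3 Du) (dy_mulc _ _ s2 Du).
move=> s1 s2 Dw.
have E1 u : D2 u -> dy a (fun u => h1 u + r * h2 u) u = dy a h1 u + r * dy a h2 u.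
  exact: E.
have E2 u : D2 u -> dy b (dy a (fun u => h1 u + r * h2 u)) u =
    dy b (dy a h1) u + r * dy b (dy a h2) u.
  move=> Du; rewrite (dy_eq_on openU2 _ E1 Du).
  by apply: E Du; exact: smooth_on_dy.
apply: etrans (dy_eq_on openU2 _ E2 Dw) _.
by apply: E Dw; do 2 apply: smooth_on_dy.
Qed.

(** The - 1/2 of the spray cancels the - 2 of [dy3_fund_inv_sqF], so the sum enters with coefficient
    + f^-1 f_nu; solving for the curvature of F2 produces the minus sign of the condition. *)
Lemma twisted_berwald_rshift z c a b l : D z ->
  let w := bproj2 z in let C := cartan_up F2 c in
  berwald T (rshift n1 c) (rshift n1 a) (rshift n1 b) (rshift n1 l) z =
  berwald F2 c a b l w +
  \sum_(nu < n2) ((k z.1)^-1 *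
     'D_(delta_mx 0 (rshift n1 nu)) (k : _ -> R^o) z.1) *
    (dy l (dy a (C nu b)) w * F2 w ^+ 2
     + 2 * dy a (C nu b) w * lower_y F2 l w
     + 2 * dy a (C nu l) w * lower_y F2 b w
     + 2 * C nu a w * fund F2 w l b
     + 2 * dy l (C nu b) w * lower_y F2 a w
     + 2 * C nu b w * fund F2 w l a
     + 2 * C nu l w * fund F2 w a b
     - 2 * fund_inv F2 w c nu * cartan F2 a b l w).
Proof.
move=> Dz w C; have [_ Dw] := Dz.
have push3 h : push2 (rshift n1 l) (push2 (rshift n1 b) (push2 (rshift n1 a) h)) =
  dy l (dy b (dy a h)) by rewrite 3!push2_rshift.
apply: etrans (berwald_rshiftE _ _ _ _ Dz) _.
rewrite /comb; apply: (f_equal2 (@GRing.add R)).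
  exact: (f_equal (fun h => h w) (push3 (spray F2 c))).
apply: eq_bigr => nu _; apply: f_equal.
apply: etrans (f_equal (fun h => h w) (push3 (W c nu))) _.
apply: etrans (dy3_linear _ _ _ _ (smooth_quad c nu) (smooth_GS c nu) Dw) _.
rewrite [X in X + _](dy3_quad _ _ _ _ _ Dw) add0r.
rewrite (dy3_fund_inv_sqF openU2 smoothF2 homogF2 posdefF2 _ _ _ _ _ Dw).
by rewrite mulrA mulrNN mulVf ?mul1r// pnatr_eq0.
Qed.

(** A derivative along the first fibre annihilates every function of (u, v) in [comb], so one index
    from the first factor makes the component vanish. *)
Lemma twisted_berwald_rshift_eq0 z c j1 j2 j3 : D z ->
  (forall a b l, berwald T (rshift n1 c) (rshift n1 a) (rshift n1 b)
                   (rshift n1 l) z = 0) ->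
  berwald T (rshift n1 c) j1 j2 j3 z = 0.
Proof.
move=> Dz B0.
case: (split_ordP j1) => i1 ->.
  rewrite (berwald_rshiftE _ _ _ _ Dz) push2_lshift !push2_0 -[RHS](comb0 z) /comb.
  by apply: f_equal; apply: eq_bigr => nu _; rewrite push2_lshift !push2_0.
case: (split_ordP j2) => i2 ->.
  rewrite (berwald_rshiftE _ _ _ _ Dz) push2_lshift !push2_0 -[RHS](comb0 z) /comb.
  by apply: f_equal; apply: eq_bigr => nu _; rewrite push2_lshift !push2_0.
case: (split_ordP j3) => i3 ->; last exact: B0.
apply: etrans (berwald_rshiftE _ _ _ _ Dz) _.
rewrite -[RHS](comb0 z) /comb; apply: (f_equal2 (@GRing.add R)).
  exact: (f_equal (fun h => h (bproj2 z)) (push2_lshift i3 _)).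
apply: eq_bigr => nu _; apply: f_equal.
exact: (f_equal (fun h => h (bproj2 z)) (push2_lshift i3 _)).
Qed.

End TwistedLocal.

(** * Twisted products *)

(** Distributes f_nu over the eight terms, as the theorem writes them; abstract variables keep the
    geometric expressions away from [ring]. *)
Lemma twisted_term (R : comRingType) (r d s x1 x2 x3 x4 x5 x6 x7 x8 x9 : R)
    (y1 y2 y3 y4 y5 y6 : R) :
  (r * d) * (x1 * s ^+ 2 + 2 * x2 * y1 + 2 * x3 * y2 + 2 * x4 * y3
    + 2 * x5 * y4 + 2 * x6 * y5 + 2 * x7 * y6 - 2 * x8 * x9) =
  r * (x1 * d * s ^+ 2 + 2 * x2 * d * y1 + 2 * x3 * d * y2 + 2 * x4 * d * y3
    + 2 * x5 * d * y4 + 2 * x6 * d * y5 + 2 * x7 * d * y6 - 2 * x8 * x9 * d).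
Proof. by ring. Qed.

Lemma delta_row_neq0 (R : realType) (n : nat) (n_gt0 : (0 < n)%N) :
  exists y : 'rV[R]_n, y != 0.
Proof.
exists (delta_mx 0 (Ordinal n_gt0)); apply/negP => /eqP/rowP/(_ (Ordinal n_gt0)).
by rewrite !mxE !eqxx => /eqP; rewrite oner_eq0.
Qed.

Lemma sqF_twisted_metric (R : realType) (n1 n2 : nat) (M1 M2 : Type)
    (A1 : atlas R n1 M1) (A2 : atlas R n2 M2)
    (F1 : local_metric A1) (F2 : local_metric A2) (f : M1 * M2 -> R) ab z :
  sqF (twisted_metric F1 F2 f ab) z = sqF (F1 ab.1) (bproj1 z) +
  f (unchart ab z.1) ^+ 2 * sqF (F2 ab.2) (bproj2 z).
Proof.
rewrite /sqF /twisted_metric sqr_sqrtr//.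
by rewrite addr_ge0 ?sqr_ge0// mulr_ge0 ?sqr_ge0.
Qed.

Lemma chart_img_prod (R : realType) (n1 n2 : nat) (M1 M2 : Type)
    (A1 : atlas R n1 M1) (A2 : atlas R n2 M2)
    (ab : chart_idx (prod_atlas A1 A2)) (x : 'rV[R]_(n1 + n2)) :
  chart_img ab.1 (lsubmx x) -> chart_img ab.2 (rsubmx x) -> chart_img ab x.
Proof.
move=> [p dp px] [q dq qx]; exists (p, q) => //=.
by rewrite px qx hsubmxK.
Qed.

(** * The twisting function in the charts of the product atlas *)

Section TwistedAtlas.
Variables (R : realType) (n1 n2 : nat) (M1 M2 : topologicalType).
Variables (A1 : atlas R n1 M1) (A2 : atlas R n2 M2) (f : M1 * M2 -> R).
Hypotheses (HM1 : smooth_manifold A1) (HM2 : smooth_manifold A2).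
Hypothesis f_const : constant_on_fst A1 f.
Variable ab : chart_idx (prod_atlas A1 A2).
Let k (x : 'rV[R]_(n1 + n2)) : R := f (unchart ab x).

Lemma derive_unchart_lshift i x : chart_img ab.1 (lsubmx x) ->
  'D_(delta_mx 0 (lshift n2 i)) (k : _ -> R^o) x = 0.
Proof.
move=> [p dp px]; rewrite -(f_const i (unchart ab.2 (rsubmx x)) dp) /coord_deriv.
apply: derive_line => t; rewrite /k /= linearP /= linearP /=.
by rewrite lsubmx_delta_lshift rsubmx_delta_lshift scaler0 add0r px.
Qed.

Lemma derive_unchart_rshift nu p q : chart_dom ab.1 p ->
  'D_(delta_mx 0 (rshift n1 nu)) (k : _ -> R^o)
     (row_mx (chart ab.1 p) (chart ab.2 q)) =
  coord_deriv ab.2 nu (fun q' => f (p, q')) q.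
Proof.
move=> dp; rewrite /coord_deriv.
apply: derive_line => t; rewrite /k /= linearP /= linearP /=.
rewrite lsubmx_delta_rshift rsubmx_delta_rshift scaler0 add0r row_mxKl row_mxKr.
by rewrite (chartK HM1 dp).
Qed.

End TwistedAtlas.

Theorem theorem7 (R : realType) (n1 n2 : nat) (M1 M2 : topologicalType)
    (A1 : atlas R n1 M1) (A2 : atlas R n2 M2)
    (F1 : local_metric A1) (F2 : local_metric A2) (f : M1 * M2 -> R)
    (n1_gt0 : (0 < n1)%N) (n2_gt0 : (0 < n2)%N)
    (M1_neq0 : [set: M1] !=set0) (M2_neq0 : [set: M2] !=set0)
    (HM1 : smooth_manifold A1) (HM2 : smooth_manifold A2)
    (HF1 : finsler F1) (HF2 : finsler F2)
    (f_smooth : smooth_fun (prod_atlas A1 A2) f)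
    (f_gt0 : forall pq : M1 * M2, 0 < f pq)
    (f_const : constant_on_fst A1 f) :
  twisted_berwaldian F1 F2 f <->
  berwaldian F1 /\
  (forall (p : M1) (b : chart_idx A2) (q : M2) (v : 'rV[R]_n2),
    chart_dom b q -> v != 0 ->
    forall c a b' l : 'I_n2,
    let Fb := F2 b in
    let z := (chart b q, v) in
    let f_ (nu : 'I_n2) := coord_deriv b nu (fun q' => f (p, q')) q in
    let C := cartan_up Fb in
    berwald Fb c a b' l z =
    - (f (p, q))^-1 *
      \sum_(nu < n2)
        (dy l (dy a (C c nu b')) z * f_ nu * Fb z ^+ 2
         + 2 * dy a (C c nu b') z * f_ nu * lower_y Fb l z
         + 2 * dy a (C c nu l) z * f_ nu * lower_y Fb b' z
         + 2 * C c nu a z * f_ nu * fund Fb z l b'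
         + 2 * dy l (C c nu b') z * f_ nu * lower_y Fb a z
         + 2 * C c nu b' z * f_ nu * fund Fb z l a
         + 2 * C c nu l z * f_ nu * fund Fb z a b'
         - 2 * fund_inv Fb z c nu * cartan Fb a b' l z * f_ nu)).
Proof.
pose ab a b : chart_idx (prod_atlas A1 A2) := (a, b).
pose U a b := [set x : 'rV[R]_(n1 + n2) | chart_img (a : chart_idx A1) (lsubmx x) /\
  chart_img (b : chart_idx A2) (rsubmx x)].
have open1 a : open (chart_img (a : chart_idx A1)) := @chart_img_open _ _ _ _ HM1 a.
have open2 b : open (chart_img (b : chart_idx A2)) := @chart_img_open _ _ _ _ HM2 b.
have smoothk a b : smooth_on (U a b)
    ((fun x => f (unchart (ab a b) x) : R) : _ -> R^o).
  move=> vs x [x1 x2].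
  exact: (f_smooth (ab a b) vs x (chart_img_prod (ab := ab a b) x1 x2)).
have k_const a b i (x : 'rV[R]_(n1 + n2)) : U a b x ->
    'D_(delta_mx 0 (lshift n2 i))
      ((fun x => f (unchart (ab a b) x) : R) : _ -> R^o) x = 0.
  move=> [x1 _]; exact: (derive_unchart_lshift f_const (ab := ab a b) i x1).
pose T a b := twisted_metric F1 F2 f (ab a b).
(* The coordinates of a tangent vector w at (p, q). *)
pose Z a b p q (w : 'rV[R]_(n1 + n2)) : 'rV[R]_(n1 + n2) * 'rV[R]_(n1 + n2) :=
  (row_mx (chart (a : chart_idx A1) p) (chart (b : chart_idx A2) q), w).
have DZ a b p q w : chart_dom (a : chart_idx A1) p ->
    chart_dom (b : chart_idx A2) q -> bislit w ->
    (chart_img a `*` @slit R n1) (bproj1 (Z a b p q w)) /\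
    (chart_img b `*` @slit R n2) (bproj2 (Z a b p q w)).
  move=> dp dq [w1 w2]; rewrite /bproj1 /bproj2 /= row_mxKl row_mxKr.
  by split; split=> //=; [exists p|exists q].
have sqT a b := sqF_twisted_metric F1 F2 f (ab a b).
have k_gt0 a b x : 0 < f (unchart (ab a b) x) by exact: f_gt0.
have BL a b := twisted_berwald_lshift (open1 a) (open2 b) (@finsler_smooth _ _ _ _ _ HF1 a)
  (@finsler_smooth _ _ _ _ _ HF2 b) (@finsler_posdef _ _ _ _ _ HF1 a)
  (@finsler_posdef _ _ _ _ _ HF2 b) (smoothk a b) (k_gt0 a b) (@k_const a b) (sqT a b).
have BL0 a b := twisted_berwald_lshift_eq0 (open1 a) (open2 b) (@finsler_smooth _ _ _ _ _ HF1 a)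
  (@finsler_smooth _ _ _ _ _ HF2 b) (@finsler_posdef _ _ _ _ _ HF1 a)
  (@finsler_posdef _ _ _ _ _ HF2 b) (smoothk a b) (k_gt0 a b) (@k_const a b) (sqT a b).
have BR a b := twisted_berwald_rshift (open1 a) (open2 b) (@finsler_smooth _ _ _ _ _ HF1 a)
  (@finsler_smooth _ _ _ _ _ HF2 b) (@finsler_homog _ _ _ _ _ HF2 b)
  (@finsler_posdef _ _ _ _ _ HF1 a)
  (@finsler_posdef _ _ _ _ _ HF2 b) (smoothk a b) (k_gt0 a b) (@k_const a b) (sqT a b).
have BR0 a b := twisted_berwald_rshift_eq0 (open1 a) (open2 b) (@finsler_smooth _ _ _ _ _ HF1 a)
  (@finsler_smooth _ _ _ _ _ HF2 b) (@finsler_homog _ _ _ _ _ HF2 b)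
  (@finsler_posdef _ _ _ _ _ HF1 a)
  (@finsler_posdef _ _ _ _ _ HF2 b) (smoothk a b) (k_gt0 a b) (@k_const a b) (sqT a b).
have Z1 a b p q w : bproj1 (Z a b p q w) = (chart a p, lsubmx w).
  by rewrite /bproj1 /= row_mxKl.
have Z2 a b p q w : bproj2 (Z a b p q w) = (chart b q, rsubmx w).
  by rewrite /bproj2 /= row_mxKr.
(* Both directions rest on this: the pure second-factor component vanishes exactly when the stated
   condition holds at that point. *)
have key a b p q w : chart_dom a p -> chart_dom b q -> bislit w ->
    forall c a' b' l : 'I_n2,
    let Fb := F2 b in
    let z := (chart b q, rsubmx w) in
    let f_ (nu : 'I_n2) := coord_deriv b nu (fun q' => f (p, q')) q in
    let C := cartan_up Fb in
    berwald (T a b) (rshift n1 c) (rshift n1 a') (rshift n1 b') (rshift n1 l)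
      (Z a b p q w) = berwald Fb c a' b' l z + (f (p, q))^-1 *
      \sum_(nu < n2)
        (dy l (dy a' (C c nu b')) z * f_ nu * Fb z ^+ 2
         + 2 * dy a' (C c nu b') z * f_ nu * lower_y Fb l z
         + 2 * dy a' (C c nu l) z * f_ nu * lower_y Fb b' z
         + 2 * C c nu a' z * f_ nu * fund Fb z l b'
         + 2 * dy l (C c nu b') z * f_ nu * lower_y Fb a' z
         + 2 * C c nu b' z * f_ nu * fund Fb z l a'
         + 2 * C c nu l z * f_ nu * fund Fb z a' b'
         - 2 * fund_inv Fb z c nu * cartan Fb a' b' l z * f_ nu).
  move=> dp dq bw c a' b' l Fb z f_ C.
  apply: etrans (BR a b _ c a' b' l (DZ a b p q w dp dq bw)) _.
  rewrite Z2 -/z -/Fb; apply: f_equal; rewrite mulr_sumr; apply: eq_bigr => nu _.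
  rewrite (derive_unchart_rshift (ab := ab a b) f HM1 nu q dp) -/(f_ nu).
  have -> : unchart (ab a b) (Z a b p q w).1 = (p, q).
    by rewrite /= row_mxKl row_mxKr (chartK HM1 dp) (chartK HM2 dq).
  exact: twisted_term.
split=> [B|[B1 B2]].
- split=> [a p y dp y0 i j1 j2 j3|p b q v dq v0 c a' b' l].
    (* The curvature of F1 at y is read off at (y, v) for an arbitrary point q and an arbitrary
       nonzero v. *)
    have [q _] := M2_neq0; have [b dq] := chart_cover HM2 q.
    have [v v0] := delta_row_neq0 R n2_gt0.
    have bw : bislit (row_mx y v) by split; rewrite ?row_mxKl ?row_mxKr.
    have := BL a b _ i j1 j2 j3 (DZ a b p q _ dp dq bw).
    rewrite Z1 row_mxKl => <-.
    exact: (B (ab a b) (p, q) (row_mx y v) (conj dp dq) bw).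
  (* Here p is prescribed, since f(p, q) occurs in the condition; only the chart and the nonzero y
     are chosen. *)
  have [a dp] := chart_cover HM1 p; have [y y0] := delta_row_neq0 R n1_gt0.
  have bw : bislit (row_mx y v) by split; rewrite ?row_mxKl ?row_mxKr.
  move=> Fb z f_ C; have := key a b p q _ dp dq bw c a' b' l.
  rewrite row_mxKr; set S := \sum_(nu < n2) _ => E.
  have := B (ab a b) (p, q) (row_mx y v) (conj dp dq) bw (rshift n1 c)
    (rshift n1 a') (rshift n1 b') (rshift n1 l).
  move=> B0; have {B0} := etrans (esym E) B0.
  by move/eqP; rewrite addr_eq0 mulNr => /eqP.
- move=> [a b] [p q] w [dp dq] bw i j1 j2 j3.
  have Dz := DZ a b p q w dp dq bw.
  (* The upper index selects the component of the spray; the mixed lower indices are handled by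
     [BL0] and [BR0]. *)
  case: (split_ordP i) => i' ->.
    apply: (BL0 a b (Z a b p q w) i' j1 j2 j3 Dz) => l1 l2 l3.
    by rewrite Z1; apply: B1 => //; case: bw.
  apply: (BR0 a b (Z a b p q w) i' j1 j2 j3 Dz) => a' b' l.
  apply: etrans (key a b p q w dp dq bw i' a' b' l) _.
  apply/eqP; rewrite addr_eq0 -mulNr; apply/eqP.
  by apply: B2 => //; case: bw.
Qed.
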